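(* Suppose $V:\mathbb{R}^n\to\mathbb{R}$ is locally Lipschitz and $h\in\mathbb{R}$, and that they satisfy: ($V_1$) $V(-q)=V(q)$; ($V_2$) there exist $\mu_1>0$ and $\mu_2\ge 0$ such that $\langle y,q\rangle\ge\mu_1V(q)-\mu_2$ for all $y\in\partial V(q)$ and all $q\in\mathbb{R}^n$; ($V_3$) there is an $M>0$ such that $V(q)\ge h$ whenever $|q|\ge M$. Then, for any such $h>\frac{\mu_2}{\mu_1}$, the system $$-\ddot q(t)\in\partial V(q),\qquad \tfrac12|\dot q|^2+V(q)=h$$ has at least one non-constant periodic solution with the given energy $h$, which can be obtained by the generalized mountain pass theorem with a closed subset for locally Lipschitz functionals (the theorem stated in the context).
   Context: Clarke generalized gradient: for a locally Lipschitz function $\Phi$ on a Banach space $X$, $\Phi^0(x,v):=\limsup_{w\to x,\ t\downarrow 0}\frac{\Phi(w+tv)-\Phi(w)}{t}$ and $\partial\Phi(x):=\{x^*\in X^*:\langle x^*,v\rangle\le\Phi^0(x,v)\ \forall v\in X\}$; $\partial V(q)$ is this set for $\Phi=V$, $X=\mathbb{R}^n$. The generalized mountain pass theorem referred to in the claim: Let $X$ be a Banach space and $\Phi:X\to\mathbb{R}$ locally Lipschitz. For $z_0,z_1\in X$ let $\Gamma:=\{c\in C^0([0,1];X):c(0)=z_0,\ c(1)=z_1\}$, $\gamma:=\inf_{c\in\Gamma}\max_{0\le t\le1}\Phi(c(t))$ and $\Phi_\gamma:=\{x\in X:\Phi(x)\ge\gamma\}$. Let $F\subset X$ be a closed subset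 such that $F\cap\Phi_\gamma$ separates $z_0$ and $z_1$, i.e. $X\setminus(F\cap\Phi_\gamma)=\Omega_0\cup\Omega_1$ with $\Omega_0,\Omega_1$ open and disjoint, $z_0\in\Omega_0$, $z_1\in\Omega_1$. Suppose that every sequence $\{x_n\}\subset X$ with $\mathrm{dist}_\delta(x_n,F)\to0$, $\Phi(x_n)\to\gamma$ and $(1+\|x_n\|)\min_{y^*\in\partial\Phi(x_n)}\|y^*\|\to0$ has a convergent subsequence. Then $\gamma$ is a critical value of $\Phi$: there is $\bar x\in X$ with $\Phi(\bar x)=\gamma$ and $0\in\partial\Phi(\bar x)$. Here $\mathrm{dist}_\delta(x,F):=\inf\{\delta(x,y):y\in F\}$, where $\delta(x_1,x_2):=\inf\left\{\int_0^1\frac{\|\dot c(t)\|}{1+\|c(t)\|}\,dt:\ c\in C^1([0,1],X),\ c(0)=x_1,\ c(1)=x_2\right\}$. *)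

(* Defs.v *)
From HB Require Import structures.
From mathcomp Require Import all_boot all_order all_algebra.
From mathcomp Require Import all_classical all_reals all_analysis.

Set Implicit Arguments.
Unset Strict Implicit.
Unset Printing Implicit Defensive.

Import Order.TTheory GRing.Theory Num.Theory.
Import numFieldNormedType.Exports.

Local Open Scope classical_set_scope.
Local Open Scope ring_scope.

Definition dotv (R : realType) (n : nat) (x y : 'rV[R]_n) : R :=
  \sum_(i < n) x ord0 i * y ord0 i.

(* The library norm on 'rV[R]_n is the sup norm; [enorm] is the Euclidean one. *)
Definition enorm (R : realType) (n : nat) (x : 'rV[R]_n) : R :=
  Num.sqrt (dotv x x).

Definition locally_lipschitz (R : realType) (X : normedModType R)
    (Phi : X -> R) : Prop :=
  forall x : X, exists2 U : set X, nbhs x U & [lipschitz Phi z | z in U].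

(* Clarke's generalized directional derivative, the upper limit of
   (Phi (w + t v) - Phi w) / t as w tends to x and t decreases to 0. *)
Definition clarke_dir (R : realType) (X : normedModType R)
    (Phi : X -> R) (x v : X) : \bar R :=
  limf_esup (fun wt : X * R => ((Phi (wt.1 + wt.2 *: v) - Phi wt.1) / wt.2)%:E)
            (filter_prod (nbhs x) (0 : R)^'+).

(* Clarke's generalized gradient on R^n, whose dual is identified with R^n
   through the Euclidean inner product. *)
Definition clarke_grad (R : realType) (n : nat) (V : 'rV[R]_n -> R)
    (q : 'rV[R]_n) : set 'rV[R]_n :=
  [set y | forall v : 'rV[R]_n, ((dotv y v)%:E <= clarke_dir V q v)%E].

(* The finite family of non-overlapping intervals [l i, r i], i < N, is listed
   from left to right. *)
Definition abs_continuous (R : realType) (X : normedModType R)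
    (a b : R) (f : R -> X) : Prop :=
  forall e : R, 0 < e -> exists2 d : R, 0 < d &
    forall (N : nat) (l r : nat -> R),
      (forall i, (i < N)%N -> a <= l i /\ l i <= r i /\ r i <= b) ->
      (forall i, (i.+1 < N)%N -> r i <= l i.+1) ->
      \sum_(i < N) (r i - l i) < d ->
      \sum_(i < N) `|f (r i) - f (l i)| < e.

(* Since the Clarke gradient is set-valued, -q'' \in dV(q) is understood in the
   usual sense of differential inclusions: q is C^1, q' is locally absolutely
   continuous, and the inclusion holds for almost every t. *)
Definition inclusion_solution (R : realType) (n : nat) (V : 'rV[R]_n -> R)
    (q : R -> 'rV[R]_n) : Prop :=
  [/\ forall t : R, derivable q t 1,
      forall a b : R, a <= b -> abs_continuous a b (derive1 q) &
      {ae @lebesgue_measure R, forall t : R,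
         derivable (derive1 q) t 1 /\ clarke_grad V (q t) (- derive1 (derive1 q) t)}].

Definition has_energy (R : realType) (n : nat) (V : 'rV[R]_n -> R) (h : R)
    (q : R -> 'rV[R]_n) : Prop :=
  forall t : R, 2^-1 * enorm (derive1 q t) ^+ 2 + V (q t) = h.

(* Main.v *)
Require Import Defs.
From HB Require Import structures.
From mathcomp Require Import all_boot all_order all_algebra.
From mathcomp Require Import all_classical all_reals all_analysis.
From mathcomp Require Import zify ring lra.
Import Order.TTheory GRing.Theory Num.Theory.
Import numFieldNormedType.Exports.
Local Open Scope classical_set_scope.
Local Open Scope ring_scope.

Set Implicit Arguments.
Unset Strict Implicit.
Unset Printing Implicit Defensive.

(** We look for a brake orbit through the origin.  Minimise the action
    int |q'|^2/2 + h - V over paths of free duration from 0 to {V >= h}.  A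
    minimiser has energy h by comparison with its changes of time, so it reaches
    {V = h} with zero velocity; reversing time there and extending by oddness at 0
    (V is even) gives a periodic solution.  Instead of minimising over a space of
    curves we minimise over finite sequences of points with a fixed time step,
    where minima exist by compactness.  There the Euler-Lagrange inclusion is the
    Fermat rule for Clarke gradients; it bounds the second differences, while
    (V2) and a summation by parts bound the duration.  As the time step tends to
    0, positions and velocities therefore converge to a C^1 curve with Lipschitz
    velocity, and the inclusion passes to the limit because Clarke's directional
    derivative is upper semicontinuous.  The limit velocity is differentiable
    almost everywhere. *)

(** * Differentiability almost everywhere of Lipschitz functions on the line *)

(** The condition mu2 / mu1 < h acts twice. Evenness puts 0 in the Clarke gradient at the origin, so
    (V2) there gives V(0) <= mu2 / mu1 < h: the path starts strictly inside the well, which makes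
    its duration positive and the solution non-constant. Moreover, where V is close to h, (V2) reads
    <y, q> >= mu1 V - mu2 > 0, so no path can linger near {V = h}; the margin mu1 h - mu2 is the
    denominator in the bound on the duration.

    The bound |q| <= M makes the minimisation compact without obstructing variations, since V < h
    forces |q| < M. The penalty per unit of time is taken equal to the time step, so it disappears
    in the limit.

    The limit curve is described by inequalities free of derivatives: a Lipschitz bound on the
    velocity, a quadratic Taylor estimate, and increments of the velocity tested against a
    direction. These survive limits, symmetries and gluing; derivatives are taken only on the final
    periodic curve. *)

Section lipschitz_derivable.
Context {R : realType}.
Notation lam := (@lebesgue_measure R).

Lemma lipschitz_continuous (f : R -> R) (L : R) :
  (forall x y, `|f x - f y| <= L * `|x - y|) -> continuous f.
Proof.
move=> fL x; apply/cvgrPdist_lt => e e0.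
have L0 : 0 <= L by have := fL 1 0; rewrite subr0 normr1 mulr1; exact: le_trans.
near=> y; apply: le_lt_trans (fL _ _) _.
apply: (@le_lt_trans _ _ ((L + 1) * `|x - y|)).
  by rewrite ler_wpM2r// lerDl.
rewrite mulrC -ltr_pdivlMr ?ltr_wpDl//.
near: y; apply: cvgr_dist_lt; first exact: cvg_id.
by rewrite divr_gt0// ltr_wpDl.
Unshelve. all: by end_near. Qed.

Lemma cumulative_pack (f : R -> R) : {homo f : x y / x <= y} -> continuous f ->
  exists g : cumulative R R, g = f :> (R -> R).
Proof.
move=> nd cf.
by exists (HB.pack_for (cumulative R R) f (isCumulative.Build R _ R f nd (right_continuousW cf))).
Qed.

Lemma lebesgue_stieltjes_itv (f : cumulative R R) (a b : R) : a <= b ->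
  lebesgue_stieltjes_measure f `]a, b]%classic = (f b - f a)%:E.
Proof.
move=> ab; rewrite /lebesgue_stieltjes_measure/measure_extension.
rewrite measurable_mu_extE/=; last exact: is_ocitv.
by rewrite wlength_itv_bnd.
Qed.

(* The Stieltjes measures of [f] and [id - f] add up to Lebesgue measure. *)
Lemma lebesgue_stieltjes_le (f : cumulative R R) :
  {homo (fun x => x - f x) : x y / x <= y} -> continuous f ->
  forall A, measurable A -> (lebesgue_stieltjes_measure f A <= lam A)%E.
Proof.
move=> nd cf A mA.
have [g gE] : exists g : cumulative R R, g = (fun x => x - f x) :> (R -> R).
  by apply: cumulative_pack => // x; apply: cvgB; [exact: cvg_id|exact: cf].
have -> : lam A = measure_add (lebesgue_stieltjes_measure f)
   (lebesgue_stieltjes_measure g) A.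
  apply: lebesgue_measure_unique => // X [[a b] _ <-].
  have [ab|ba] := leP a b; last first.
    by rewrite /= set_itv_ge -?leNgt ?bnd_simp ?ltW// !measure0.
  apply: (etrans (lebesgue_stieltjes_itv _ ab)); apply: esym.
  apply: etrans (measure_addE _ _ _) _.
  apply: (etrans (f_equal2 adde (lebesgue_stieltjes_itv f ab) (lebesgue_stieltjes_itv g ab))).
  rewrite /= gE; congr EFin; rewrite /=. by ring.
by rewrite measure_addE leeDl.
Qed.


(** The Stieltjes measure of [f] is dominated by Lebesgue measure, so it has a Radon-Nikodym
    density; [f] is then an indefinite integral up to a constant, and Lebesgue differentiation
    applies. Restricting to []-n, n]] makes the measure finite. *)
Lemma cumulative_derivable_ae (f : cumulative R R) (n : R) :
  {homo (fun x => x - f x) : x y / x <= y} -> continuous f -> 0 < n ->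
  {ae lam, forall x : R, - n < x < n -> derivable f x 1}.
Proof.
move=> nd cf n0.
pose I : set (measurableTypeR R) := `]- n, n]%classic.
have mI : measurable I.
  exact: measurable_itv.
have finI : (lebesgue_stieltjes_measure f I < +oo)%E.
  by rewrite lebesgue_stieltjes_itv ?ltry//; lra.
pose nu : {finite_measure set (measurableTypeR R) -> \bar R} := mfrestr mI finI.
have numu : nu `<< lam.
  move=> A A0 B mB BA; apply/eqP; rewrite eq_le measure_ge0 andbT.
  rewrite -(A0 _ mB BA); apply: le_trans (lebesgue_stieltjes_le nd cf mB).
  by apply: le_measure; rewrite ?inE//; apply: measurableI.
have [phi [phi0 phifin iphi phiE]] := radon_nikodym_sigma_finite numu.
pose p x := fine (phi x).
have pE : EFin \o p = phi by apply/funext => x; rewrite /p/= fineK.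
have ip : lam.-integrable setT (EFin \o p) by rewrite pE.
have ip' y : lam.-integrable [set` Interval (BRight (- n)) (BRight y)] (EFin \o p).
  by apply: integrableS ip => //; exact: measurable_itv.
have lp : locally_integrable setT p.
  by apply: open_integrable_locally ip; exact: openT.
have := FTC1 ip' lp.
apply: filterS; first exact: (ae_filter_ringOfSetsType lam).
move=> x + /andP[nx xn].
rewrite lte_fin => /(_ nx)[+ _] => dF.
have := derivableD dF (@derivable_cst _ _ _ (f (- n)) x 1).
apply: near_eq_derivable; near=> y.
have ny : - n < y by near: y; apply: lt_nbhsr.
have yn : y < n by near: y; apply: lt_nbhsl.
apply: (@etrans _ _ ((f y - f (- n)) + f (- n))); last by rewrite subrK.
congr (_ + _); rewrite /Rintegral.
have mJ : measurable (`]- n, y]%classic : set (measurableTypeR R)).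
  exact: measurable_itv.
transitivity (fine (nu `]- n, y]%classic)).
  by rewrite (phiE _ mJ) -pE.
rewrite /nu/= /mfrestr/= /mrestr/= setIidl.
  by rewrite lebesgue_stieltjes_itv// ltW.
by apply: subset_itvl; rewrite bnd_simp ltW.
Unshelve. all: by end_near. Qed.

Lemma lipschitz_derivable_ae (f : R -> R) (L : R) :
  (forall x y, `|f x - f y| <= L * `|x - y|) ->
  {ae lam, forall x : R, derivable f x 1}.
Proof.
move=> fL; have L0 : 0 <= L.
  by have := fL 1 0; rewrite subr0 normr1 mulr1; exact: le_trans.
(* With this factor [k * f] varies at most half as fast as the identity, so x / 2 + k f(x) and x / 2
   - k f(x) are both nondecreasing. Using [L + 1] covers [L = 0]. *)
pose k := (2 * (L + 1))^-1.
have k0 : 0 < k by rewrite invr_gt0; lra.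
have kL x y : `|k * (f x - f y)| <= 2^-1 * `|x - y|.
  rewrite normrM gtr0_norm// mulrC -ler_pdivlMr// (le_trans (fL x y))//.
  by rewrite mulrAC ler_wpM2r// /k invrK mulrA mulVf ?pnatr_eq0//; lra.
have kL' x y : x <= y -> - (2^-1 * (y - x)) <= k * (f y - f x) <= 2^-1 * (y - x).
  by move=> xy; have := kL y x; rewrite ler_norml [`|y - x|]ger0_norm// subr_ge0.
pose h := fun x => x / 2 + k * f x.
have ch : continuous h.
  move=> x; apply: cvgD; first by apply: cvgMr_tmp; exact: cvg_id.
  by apply: cvgMl_tmp; exact: lipschitz_continuous fL x.
have [g gE] : exists g : cumulative R R, g = h :> (R -> R).
  apply: cumulative_pack => // x y xy.
  by have /andP[] := kL' x y xy; rewrite /h; lra.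
have nd : {homo (fun x => x - g x) : x y / x <= y}.
  move=> x y xy; rewrite gE.
  by have /andP[] := kL' x y xy; rewrite /h; lra.
have gd (i : nat) : {ae lam, forall x : R, - i.+1%:R < x < i.+1%:R -> derivable g x 1}.
  by apply: cumulative_derivable_ae => //; rewrite gE.
have := ae_foralln gd.
apply: filterS.
move=> x gx; have {}gx : derivable g x 1.
  apply: (gx (Num.bound x)); rewrite -ltr_norml.
  by rewrite (lt_trans (unstable.ltr_norm_bound _))// ltr_nat.
rewrite gE in gx; pose i2 : R -> R := fun x => x / 2.
have -> : f = k^-1 \*: (h - i2).
  apply/funext => y; rewrite (_ : f y = k^-1 * (h y - i2 y))//.
  rewrite /h /i2 addrAC subrr add0r mulKf// gt_eqF//.
apply: derivableZ; apply: derivableB => //.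
Qed.
End lipschitz_derivable.

(** * The Euclidean product and the sup norm *)

Section dotv_theory.
Context {R : realType} {n : nat}.
Implicit Types x y z : 'rV[R]_n.

Lemma dotvC x y : dotv x y = dotv y x.
Proof. by apply: eq_bigr => i _; rewrite mulrC. Qed.

Lemma dotvDl x y z : dotv (x + y) z = dotv x z + dotv y z.
Proof. by rewrite -big_split; apply: eq_bigr => i _; rewrite mxE mulrDl. Qed.

Lemma dotvZl a x y : dotv (a *: x) y = a * dotv x y.
Proof. by rewrite mulr_sumr; apply: eq_bigr => i _; rewrite mxE mulrA. Qed.

Lemma dotvNl x y : dotv (- x) y = - dotv x y.
Proof. by rewrite -scaleN1r dotvZl mulN1r. Qed.

Lemma dotvBl x y z : dotv (x - y) z = dotv x z - dotv y z.
Proof. by rewrite dotvDl dotvNl. Qed.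

Lemma dotvDr x y z : dotv x (y + z) = dotv x y + dotv x z.
Proof. by rewrite dotvC dotvDl !(dotvC x). Qed.

Lemma dotvZr a x y : dotv x (a *: y) = a * dotv x y.
Proof. by rewrite dotvC dotvZl dotvC. Qed.

Lemma dotvNr x y : dotv x (- y) = - dotv x y.
Proof. by rewrite dotvC dotvNl dotvC. Qed.

Lemma dotv0l x : dotv 0 x = 0.
Proof. by rewrite -(scale0r x) dotvZl mul0r. Qed.

Lemma dotv_ge0 x : 0 <= dotv x x.
Proof. by apply: sumr_ge0 => i _; rewrite -expr2 sqr_ge0. Qed.

Lemma dotv_delta x j : dotv x (delta_mx ord0 j) = x ord0 j.
Proof.
rewrite /dotv (bigD1 j)//= big1 ?addr0 => [|i ij]; rewrite mxE ?eqxx ?mulr1//.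
by rewrite (negbTE ij) andbF mulr0.
Qed.

Lemma coord_le_norm x j : `|x ord0 j| <= `|x|.
Proof.
rewrite [leRHS]/Num.Def.normr/= mx_normrE.
exact: (le_bigmax _ (fun ij : 'I_1 * 'I_n => `|x ij.1 ij.2|) (ord0, j)).
Qed.

Lemma norm_le_coord x (e : R) : 0 <= e -> (forall j, `|x ord0 j| <= e) -> `|x| <= e.
Proof.
move=> e0 xe; rewrite [leLHS]/Num.Def.normr/= mx_normrE bigmax_le// => -[i j] _ /=.
by rewrite (ord1 i).
Qed.

Lemma dotv_le x y : `|dotv x y| <= n%:R * (`|x| * `|y|).
Proof.
apply: le_trans (ler_norm_sum _ _ _) _.
apply: (@le_trans _ _ (\sum_(i < n) (`|x| * `|y|))).
  by apply: ler_sum => i _; rewrite normrM ler_pM// coord_le_norm.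
by rewrite sumr_const card_ord mulr_natl.
Qed.

Lemma coord_sqr_le_dotv x j : x ord0 j ^+ 2 <= dotv x x.
Proof.
rewrite /dotv (bigD1 j)//= -expr2 lerDl sumr_ge0// => i _.
by rewrite -expr2 sqr_ge0.
Qed.

Lemma norm_le_of_dotv x (c : R) : 0 <= c -> dotv x x <= c ^+ 2 -> `|x| <= c.
Proof.
move=> c0 xc; apply: norm_le_coord => // j.
rewrite -(ler_pXn2r (n := 2)) ?nnegrE// real_normK ?num_real//.
exact: le_trans (coord_sqr_le_dotv x j) xc.
Qed.

Lemma enorm_sqr x : enorm x ^+ 2 = dotv x x.
Proof. by rewrite /enorm sqr_sqrtr// dotv_ge0. Qed.

Lemma norm_le_enorm x : `|x| <= enorm x.
Proof. by rewrite norm_le_of_dotv ?sqrtr_ge0// enorm_sqr. Qed.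

Lemma norm_ball_compact (r : R) : compact [set x : 'rV[R]_n | `|x| <= r].
Proof.
apply: bounded_closed_compact.
  exists r; split; first exact: num_real.
  by move=> r' rr' x /= xr; exact: le_trans xr (ltW rr').
apply: (@closed_comp _ _ (fun x : 'rV[R]_n => `|x|) [set t | t <= r]).
  by move=> x _; exact: norm_continuous.
exact: closed_le.
Qed.

Lemma lipschitz_derivable_rV_ae (f : R -> 'rV[R]_n) (L : R) :
  (forall s t, `|f s - f t| <= L * `|s - t|) ->
  {ae (@lebesgue_measure R), forall x : R, derivable f x 1}.
Proof.
move=> fL.
have fi (j : 'I_n) : {ae (@lebesgue_measure R), forall x : R,
    derivable (fun t => f t ord0 j) x 1}.
  apply: (lipschitz_derivable_ae (L := L)) => x y; apply: le_trans (fL x y).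
  by apply: le_trans (coord_le_norm _ j); rewrite !mxE.
(* Countable intersections of full sets are indexed by [nat], so coordinates are addressed by their
   value; the claim is vacuous for [k] beyond the dimension. *)
have gi (k : nat) : {ae (@lebesgue_measure R), forall t : R,
    forall j : 'I_n, nat_of_ord j = k -> derivable (fun t => f t ord0 j) t 1}.
  case: (pselect (exists j : 'I_n, nat_of_ord j = k)) => [[j jk]|nj].
    have := fi j; apply: filterS; first exact: (ae_filter_ringOfSetsType (@lebesgue_measure R)).
    move=> t h i ik.
    by rewrite (_ : i = j)//; apply: val_inj; rewrite /= ik jk.
  by apply: aeW => t j jk; case: nj; exists j.
have := ae_foralln gi.
apply: filterS => t h; apply/derivable_mxP => i j.
by rewrite (ord1 i); exact: h.
Qed.

End dotv_theory.

(** * Clarke directional derivatives *)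

Section clarke.
Context {R : realType} {X : normedModType R}.
Variable (Phi : X -> R).
Implicit Types (x v w : X) (b t r : R).

Let prod_right (A : set (X * R)) x :
  filter_prod (nbhs x) (0 : R)^'+ A ->
  exists2 r, 0 < r & forall w t, `|w - x| < r -> 0 < t < r -> A (w, t).
Proof.
case=> -[B C] /= [xB]; rewrite /at_right /within/= => C0 BC.
move: xB => /nbhs_normP[r /= r0 rB]; move: C0 => /nbhs_normP[s /= s0 sC].
exists (Num.min r s); first by rewrite lt_min r0.
move=> w t; rewrite !lt_min => /andP[wr _] /andP[t0 /andP[_ ts]].
apply: BC; split => /=; first by apply: rB; rewrite /= distrC.
by apply: sC => //=; rewrite sub0r normrN gtr0_norm.
Qed.

Let prod_right_ball x r : 0 < r ->
  filter_prod (nbhs x) (0 : R)^'+ [set wt | `|wt.1 - x| < r /\ 0 < wt.2 < r].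
Proof.
move=> r0; exists ([set w | `|w - x| < r], [set t | 0 < t < r]) => /=; last first.
  by move=> [w t] /= [].
split; first by apply/nbhs_normP; exists r => //= w /=; rewrite distrC.
rewrite /at_right /within/=; apply/nbhs_normP; exists r => //= t /= + t0.
by rewrite sub0r normrN gtr0_norm// t0.
Qed.

(** Up to an arbitrarily small change of [b] this says that the directional derivative is at most
    [b]. As a real inequality on a whole neighbourhood, without division, it can be summed along a
    path and carried to nearby points. *)
Definition clarke_bound x v b : Prop :=
  exists2 r, 0 < r & forall w t, `|w - x| < r -> 0 < t < r ->
    Phi (w + t *: v) - Phi w <= b * t.

Lemma clarke_dir_lt x v b : (clarke_dir Phi x v < b%:E)%E -> clarke_bound x v b.
Proof.
rewrite /clarke_dir /limf_esup => /ereal_inf_lt[_ [A FA <-]] Ab.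
have [r r0 rA] := prod_right FA; exists r => // w t wx /[dup] /andP[t0 _] tr.
rewrite -ler_pdivrMr// -lee_fin; apply: le_trans (ltW Ab).
by apply: ereal_sup_ubound; exists (w, t) => //; exact: rA.
Qed.

Lemma clarke_dir_le x v b : clarke_bound x v b ->
  (clarke_dir Phi x v <= b%:E)%E.
Proof.
move=> [r r0 rP]; rewrite /clarke_dir /limf_esup.
apply: le_trans.
  by apply: ereal_inf_lbound; exists [set wt | `|wt.1 - x| < r /\ 0 < wt.2 < r];
    [exact: prod_right_ball|reflexivity].
apply: ge_ereal_sup => _ [[w t] /= [wx /[dup] /andP[t0 _] tr] <-].
by rewrite lee_fin ler_pdivrMr// rP.
Qed.

Lemma le_clarke_dir x v b :
  (forall r e, 0 < r -> 0 < e -> exists w t, [/\ `|w - x| < r, 0 < t < r &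
    (b - e) * t <= Phi (w + t *: v) - Phi w]) ->
  (b%:E <= clarke_dir Phi x v)%E.
Proof.
move=> H; apply: le_ereal_inf_tmp => _ [A FA <-].
have [r r0 rA] := prod_right FA.
apply/lee_subgt0Pr => e e0.
have [w [t [wx /[dup] tr /andP[t0 _] Phit]]] := H r e r0 e0.
rewrite -EFinB; apply: (@le_trans _ _ (((Phi (w + t *: v) - Phi w) / t)%:E)).
  by rewrite lee_fin ler_pdivlMr.
by apply: ereal_sup_ubound; exists (w, t) => //; exact: rA.
Qed.

(** Otherwise a real number fits strictly between the directional derivative, possibly -oo, and [b],
    and it is a [clarke_bound]. *)
Lemma le_clarke_dirP x v b :
  (forall c : R, clarke_bound x v c -> b <= c) -> (b%:E <= clarke_dir Phi x v)%E.
Proof.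
move=> H; rewrite leNgt; apply/negP => lt.
suff [c [cb cl]] : exists c, c < b /\ (clarke_dir Phi x v < c%:E)%E.
  by have := H c (clarke_dir_lt cl); rewrite leNgt cb.
move: lt; case: (clarke_dir _ _ _) => [c|//|_].
- by rewrite lte_fin => cb; exists ((b + c) / 2); rewrite lte_fin; split; lra.
- by exists (b - 1); rewrite ltNyr; split=> //; lra.
Qed.

Lemma clarke_bound_opp x v b : (forall y, Phi (- y) = Phi y) ->
  clarke_bound (- x) v b -> clarke_bound x (- v) b.
Proof.
move=> ev [r r0 H]; exists r => // w t wx tr.
have := H (- w) t; rewrite -opprD normrN -[- w + _]opprK opprD opprK ev -scalerN ev.
by apply => //; rewrite opprB addrC.
Qed.

(** This is upper semicontinuity in the base point: a ball of half the radius around a nearby point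
    stays in the original ball. *)
Lemma clarke_bound_near x v b : clarke_bound x v b ->
  exists2 r, 0 < r & forall y, `|y - x| < r -> clarke_bound y v b.
Proof.
move=> [r r0 H]; exists (r / 2); first by rewrite divr_gt0.
move=> y yx; exists (r / 2); first by rewrite divr_gt0.
move=> w t wy /andP[t0 tr]; apply: H; last by rewrite t0; lra.
by have := ler_normD (w - y) (y - x); rewrite addrA subrK; lra.
Qed.
End clarke.

Section clarke_grad.
Context {R : realType} {n : nat}.
Variable (V : 'rV[R]_n -> R).

Lemma clarke_grad_le q y v b :
  clarke_grad V q y -> clarke_bound V q v b -> dotv y v <= b.
Proof.
by move=> /(_ v) yq /clarke_dir_le/(le_trans yq); rewrite lee_fin.
Qed.

(** On the segment from -(t/2) v to (t/2) v, centred at the origin, an even function has zero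
    increment, so every directional derivative at 0 is nonnegative. *)
Lemma clarke_grad0 : (forall q, V (- q) = V q) -> clarke_grad V 0 0.
Proof.
move=> ev v; rewrite dotv0l; apply: le_clarke_dir => r e r0 e0.
pose t := r / (1 + `|v|) / 2; have v1 : 0 < 1 + `|v| by rewrite ltr_wpDr.
have t0 : 0 < t by rewrite /t !divr_gt0.
exists (- (t / 2) *: v), t.
have tr : t * (1 + `|v|) = r / 2 by rewrite /t; field; rewrite gt_eqF.
have tr' : t * `|v| >= 0 by rewrite mulr_ge0// ltW.
have -> : - (t / 2) *: v + t *: v = - (- (t / 2) *: v).
  by rewrite -[RHS]scaleNr -scalerDl; congr (_ *: _); lra.
rewrite ev subrr t0/=; split.
- by rewrite subr0 normrZ normrN gtr0_norm ?divr_gt0//; lra.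
- by lra.
- by nra.
Qed.
End clarke_grad.

(** * Local Lipschitz constants, uniform on compact sets *)

Section local_lipschitz.
Context {R : realType} {X : normedModType R}.
Implicit Types (V : X -> R) (x y z : X) (L : R).

Definition lipschitz_near V x L : Prop :=
  exists2 r : R, 0 < r & forall y z, `|y - x| < r -> `|z - x| < r ->
    `|V y - V z| <= L * `|y - z|.

Lemma locally_lipschitzP V : locally_lipschitz V ->
  forall x, exists2 L, 0 <= L & lipschitz_near V x L.
Proof.
move=> VL x; have [U /nbhs_normP[r /= r0 rU]] := VL x.
rewrite /lipschitz_on /= => -[L0 [_ LP]].
exists (`|L0| + 1); first by rewrite addr_ge0.
exists r => // y z yx zx; apply: (LP (`|L0| + 1) _ (y, z)).
  by rewrite (le_lt_trans (ler_norm _))// ltrDl.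
by split; apply: rU; rewrite /= distrC.
Qed.

Lemma lipschitz_near_continuous V x L : lipschitz_near V x L -> {for x, continuous V}.
Proof.
move=> [r r0 H]; apply/cvgrPdist_lt => e e0; near=> y.
apply: le_lt_trans (H x y _ _) _.
- by rewrite subrr normr0.
- near: y; apply/nbhs_normP; exists r => // y /=; by rewrite distrC.
apply: (@le_lt_trans _ _ ((`|L| + 1) * `|x - y|)).
  by rewrite ler_wpM2r// (le_trans (ler_norm L))// lerDl.
rewrite mulrC -ltr_pdivlMr ?ltr_wpDl//.
near: y; apply: cvgr_dist_lt; first exact: cvg_id.
by rewrite divr_gt0// ltr_wpDl.
Unshelve. all: by end_near. Qed.

Lemma lipschitz_near_bound V x L v : lipschitz_near V x L ->
  clarke_bound V x v (L * `|v|).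
Proof.
move=> [r r0 H]; pose s := r / (2 * (1 + `|v|)).
have v1 : 0 < 1 + `|v| by rewrite ltr_wpDr.
have s0 : 0 < s by rewrite /s divr_gt0// mulr_gt0.
have sr : s * (1 + `|v|) = r / 2 by rewrite /s; field; rewrite gt_eqF.
have v0 := normr_ge0 v.
have sr2 : s <= r / 2 by nra.
exists s => // w t wx /andP[t0 ts]; apply: le_trans (ler_norm _) _.
have tv : `|t *: v| = t * `|v| by rewrite normrZ gtr0_norm.
apply: le_trans (H _ _ _ _) _.
- have := ler_normD (w - x) (t *: v); rewrite tv addrAC; nra.
- lra.
- by rewrite addrAC subrr add0r tv mulrA mulrAC.
Qed.

(** The points around which the integer [k] serves as local constant form an open set [U k], and
    finitely many of these cover [K]. The sum of the selected indices dominates each of them. Only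
    the constant is uniform, not the radius, which is enough to bound gradients. *)
Lemma lipschitz_near_uniform V (K : set X) : locally_lipschitz V -> compact K ->
  exists2 L, 0 <= L & forall x, K x -> lipschitz_near V x L.
Proof.
move=> /locally_lipschitzP VL; rewrite compact_cover => cK.
pose U (k : nat) : set X := [set x | \forall y \near x, lipschitz_near V y k%:R].
have Uo k : [set: nat] k -> open (U k).
  by move=> _; rewrite openE => x /nbhs_interior.
have KU : K `<=` \bigcup_(k in setT) U k.
  move=> x _; have [L L0 [r r0 H]] := VL x.
  exists (Num.bound L) => //; apply/nbhs_normP; exists (r / 2) => /=; first by lra.
  move=> y /=; rewrite distrC => yx; exists (r / 2); first by lra.
  move=> a b ay yb; apply: (@le_trans _ _ (L * `|a - b|)); last first.
    by rewrite ler_wpM2r// ltW// archi_boundP.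
  by apply: H; [have := ler_normD (a - y) (y - x)|have := ler_normD (b - y) (y - x)];
    rewrite addrA subrK; lra.
have [D _ KD] := cK _ _ _ Uo KU.
exists (\sum_(k <- finmap.enum_fset D) k)%:R => // x /KD[k kD /nbhs_singleton [r r0 H]].
exists r => // a b ax bx; apply: le_trans (H a b ax bx) _.
by rewrite ler_wpM2r// ler_nat (big_rem k)//= leq_addr.
Qed.
End local_lipschitz.

(** * Minimal discrete paths *)

Lemma cvg_sumr (R : realType) (W : normedModType R) {T I : Type}
    (F : set_system T) {FF : Filter F} (r : seq I)
    (f : I -> T -> W) (l : I -> W) : (forall k : I, f k @ F --> l k) ->
  (fun t => \sum_(k <- r) f k t) @ F --> \sum_(k <- r) l k.
Proof.
move=> fl; elim: r => [|i r IH].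
  by rewrite big_nil; under eq_fun do rewrite big_nil; exact: cvg_cst.
rewrite big_cons; under eq_fun do rewrite big_cons; exact: cvgD.
Qed.

Section discrete.
Context {R : realType} {n : nat}.
Variables (V : 'rV[R]_n -> R) (h M : R).
Hypothesis Vc : continuous V.
Implicit Types (q p : nat -> 'rV[R]_n) (N i j m : nat) (x y z : 'rV[R]_n).

(* The truncation at [0] makes the cost bounded below without having to confine
   the paths to the potential well. *)
Definition well x : R := Num.max (h - V x) 0.

(* Discretisation, with time step [d], of the Lagrangian |q'|^2/2 + h - V; the
   penalty [e] per unit of time bounds the number of steps of a minimiser. *)
Definition step_cost (d e : R) x y : R :=
  dotv (y - x) (y - x) / (2 * d) + d * (well x + e).

Definition path_cost d e q N : R := \sum_(i < N) step_cost d e (q i) (q i.+1).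

(** Paths are infinite sequences of which only the first [N + 1] terms matter. Bounding all terms
    makes the set compact for the product topology. *)
Definition admissible q N : Prop :=
  [/\ q 0%N = 0, forall i, `|q i| <= M & h <= V (q N)].

Lemma well_ge0 x : 0 <= well x.
Proof. by rewrite /well le_max lexx orbT. Qed.

Lemma well_inside x : V x < h -> well x = h - V x.
Proof. by move=> Vx; rewrite /well max_l// subr_ge0 ltW. Qed.

Lemma well_continuous : continuous well.
Proof.
move=> /= x; suff : {for x, continuous ((fun x => h - V x) \max cst 0)} by [].
have hV : h - V y @[y --> x] --> h - V x.
  by apply: (@cvgB _ _ _ (nbhs x) _ (fun=> h) V); [exact: cvg_cst|exact: Vc].
by apply: continuous_max => //; apply: cst_continuous.
Qed.

Lemma dotv_cvg {T : Type} (F : set_system T) {FF : Filter F}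
    (f g : T -> 'rV[R]_n) x y :
  f @ F --> x -> g @ F --> y -> (fun t => dotv (f t) (g t)) @ F --> dotv x y.
Proof.
move=> fx gy; rewrite /dotv.
apply: cvg_sumr => i.
have cc z : {for z, continuous (fun z : 'rV[R]_n => z ord0 i)} by exact: coord_continuous.
apply: cvgM; first exact: (cvg_comp _ _ fx (cc x)).
exact: (cvg_comp _ _ gy (cc y)).
Qed.

Variables (d e : R).
Hypotheses (d0 : 0 < d) (e0 : 0 < e).

Lemma step_cost_ge x y : d * e <= step_cost d e x y.
Proof.
have ww := mulr_ge0 (ltW d0) (well_ge0 x).
have : 0 <= dotv (y - x) (y - x) / (2 * d) 
  by apply: divr_ge0; [exact: dotv_ge0|rewrite mulr_ge0// ltW].
by rewrite /step_cost; lra.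
Qed.

Lemma path_cost_ge q N : N%:R * (d * e) <= path_cost d e q N.
Proof.
rewrite -[N in leLHS]card_ord -sum1_card natr_sum mulr_suml.
by apply: ler_sum => i _; rewrite mul1r step_cost_ge.
Qed.

Import ArrowAsProduct.

Lemma path_cost_continuous N : continuous (fun q => path_cost d e q N).
Proof.
have pc i : continuous (fun q : nat -> 'rV[R]_n => q i).
  exact: (@proj_continuous _ (fun=> 'rV[R]_n) i).
move=> /= q; rewrite /path_cost.
apply: (@cvg_sumr R R _ _ (nbhs q) _ _ (fun (k : 'I_N) q => step_cost d e (q k) (q k.+1))
  (fun (k : 'I_N) => step_cost d e (q k) (q k.+1))) => k.
have dc : (fun q => dotv (q k.+1 - q k) (q k.+1 - q k)) @ q
    --> dotv (q k.+1 - q k) (q k.+1 - q k).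
  have bc : (fun q => q k.+1 - q k) @ q --> q k.+1 - q k.
    exact: (@cvgB _ _ _ (nbhs q) _ (fun q => q k.+1) (fun q => q k) _ _ (pc _ q) (pc _ q)).
  exact: (@dotv_cvg _ (nbhs q) _ _ _ _ _ bc bc).
have wc : (fun q => well (q k)) @ q --> well (q k).
  exact: (continuous_comp (pc k q) (@well_continuous (q k))).
rewrite /step_cost.
apply: (@cvgD _ _ _ (nbhs q) _ (fun q => dotv (q k.+1 - q k) (q k.+1 - q k) / (2 * d))
  (fun q => d * (well (q k) + e))).
  exact: (@cvgMr_tmp _ _ (nbhs q) _ _ _ _ dc).
apply: (@cvgMl_tmp _ _ (nbhs q) _ (fun q => well (q k) + e)).
exact: (@cvgD _ _ _ (nbhs q) _ _ (fun=> e) _ _ wc (cvg_cst e)).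
Qed.

(** Tychonoff gives compactness of the bounded sequences; the end conditions are closed and the cost
    is continuous, as both involve finitely many coordinates. *)
Lemma min_path_fixed N : (exists q, admissible q N) ->
  exists2 q, admissible q N &
    forall p, admissible p N -> path_cost d e q N <= path_cost d e p N.
Proof.
move=> [q0 aq0].
pose B : set 'rV[R]_n := [set x | `|x| <= M].
have cB : compact B by exact: norm_ball_compact.
have pc i : continuous (fun q : nat -> 'rV[R]_n => q i).
  exact: (@proj_continuous _ (fun=> 'rV[R]_n) i).
have cA : compact [set q | admissible q N].
  have -> : [set q | admissible q N] = ([set q | q 0%N = 0] `&` [set q | h <= V (q N)])
     `&` [set q : nat -> 'rV[R]_n | forall i, B (q i)].
    by apply/seteqP; split => [q [? ? ?]|q [[? ?] ?]].
  rewrite setIC; apply: compact_closedI; first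
    exact: (@tychonoff _ (fun=> 'rV[R]_n) (fun=> B) (fun=> cB)).
  apply: closedI.
    apply: (@closed_comp _ _ (fun q : nat -> 'rV[R]_n => q 0%N) [set 0]).
      by move=> q _; exact: pc.
    by apply: accessible_closed_set1; apply: hausdorff_accessible; exact: norm_hausdorff.
  apply: (@closed_comp _ _ (fun q : nat -> 'rV[R]_n => V (q N)) [set r | h <= r]).
    by move=> q _; apply: continuous_comp; [exact: pc|exact: Vc].
  exact: closed_ge.
have [|c ca cmin] := @compact_EVT_min _ R (fun q => path_cost d e q N) _
    (ex_intro _ q0 aq0) cA.
  by apply: continuous_subspaceT; exact: path_cost_continuous.
by exists c; [exact: set_mem|move=> p ap; apply: cmin; exact: mem_set].
Qed.

(** Each step costs at least [d * e], so paths of [B] or more steps are dearer than [q0], and only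
    finitely many numbers of steps compete. *)
Lemma min_path N0 q0 : admissible q0 N0 ->
  exists q N, admissible q N /\
    forall p N', admissible p N' -> path_cost d e q N <= path_cost d e p N'.
Proof.
move=> aq0; pose c0 := path_cost d e q0 N0.
pose B := Num.bound (c0 / (d * e)).
have de0 : 0 < d * e by rewrite mulr_gt0.
have longB p N' : (B <= N')%N -> c0 < path_cost d e p N'.
  move=> BN; apply: lt_le_trans (path_cost_ge p N'); rewrite -ltr_pdivrMr//.
  by apply: lt_le_trans (unstable.ltr_bound _) _; rewrite ler_nat.
have N0B : (N0 < B)%N by rewrite ltnNge; apply/negP => /(longB q0); rewrite ltxx.
(* [(f N).2] is the minimal cost with [N] steps, or a junk value above [c0] if
   no admissible path has [N] steps. *)
have /choice[f fP] (N : nat) : exists qc : (nat -> 'rV[R]_n) * R,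
   (admissible qc.1 N /\ qc.2 = path_cost d e qc.1 N /\
      forall p, admissible p N -> qc.2 <= path_cost d e p N) \/
   (~ (exists q, admissible q N) /\ c0 < qc.2).
  case: (pselect (exists q, admissible q N)) => [/min_path_fixed[q aq qm]|nq].
    by exists (q, path_cost d e q N); left.
  by exists (q0, c0 + 1); right; split => //=; lra.
pose v (i : 'I_B) := (f i).2.
have [i _ imin] := @arg_minP _ R _ (Ordinal N0B) xpredT v isT.
have [[aq [qE qm]]|[nq]] := fP i; last first.
  have := imin (Ordinal N0B) isT; rewrite /v /=.
  have [[_ [_ /(_ _ aq0)]]|[]] := fP N0; last by case; exists q0.
  rewrite -/c0; lra.
exists (f i).1, i; split => // p N' ap; rewrite -qE.
have [N'B|BN'] := ltnP N' B.
  have := imin (Ordinal N'B) isT; rewrite /v /= => /le_trans; apply.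
  by have [[_ [_ /(_ _ ap)]]|[]] := fP N' => //; case; exists p.
apply: le_trans (ltW (longB p _ BN')).
have := imin (Ordinal N0B) isT; rewrite /v /= => /le_trans; apply.
by have [[_ [_ /(_ _ aq0)]]|[]] := fP N0 => //; case; exists q0.
Qed.
End discrete.

(** * Comparison of a minimiser with modified paths *)

Section splice.
Context {R : realType} {n : nat}.
Variables (V : 'rV[R]_n -> R) (h M d e : R).
Implicit Types (q p r : nat -> 'rV[R]_n) (N i j m : nat) (x y z : 'rV[R]_n).
Local Notation cost := (path_cost V h d e).
Local Notation step := (step_cost V h d e).

Lemma path_costD q i j : cost q (i + j) = cost q i + cost (fun k => q (i + k)%N) j.
Proof.
rewrite /path_cost big_split_ord/=; congr (_ + _).
by apply: eq_bigr => k _; rewrite addnS.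
Qed.

Lemma eq_path_cost q p N : (forall j, (j <= N)%N -> q j = p j) -> cost q N = cost p N.
Proof. by move=> qp; apply: eq_bigr => k _; rewrite !qp// ltnW. Qed.

(** The [m] steps of [q] after index [i] are cut out and replaced by [m'] steps of [p]. That [m] and
    [m'] may differ is how the free duration enters. *)
Lemma splice q N i m p m' : admissible V h M q N -> (i + m <= N)%N ->
  (forall j, `|p j| <= M) -> p 0%N = q i -> p m' = q (i + m)%N ->
  exists r N', admissible V h M r N' /\
    cost r N' = cost q N - cost (fun k => q (i + k)%N) m + cost p m'.
Proof.
move=> [q0 qM qN] imN pM p0 pm.
pose r j := if (j <= i)%N then q j else if (j <= i + m')%N then p (j - i)%N
            else q (j - (i + m') + (i + m))%N.
have r1 j : (j <= i)%N -> r j = q j by rewrite /r => ->.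
have r2 j : (j <= m')%N -> r (i + j)%N = p j.
  move=> jm; rewrite /r; case: ifPn => [ij|_].
    by (have -> : j = 0%N by lia); rewrite addn0 p0.
  by rewrite leq_add2l jm addKn.
have r3 j : r (i + m' + j)%N = q (i + m + j)%N.
  have [->|j0] := eqVneq j 0%N; first by rewrite !addn0 r2 ?pm.
  rewrite /r; have -> : (i + m' + j <= i)%N = false by lia.
  have -> : (i + m' + j <= i + m')%N = false by lia.
  by congr q; lia.
exists r, (i + m' + (N - (i + m)))%N; split.
  split; first by rewrite r1.
  - by move=> j; rewrite /r; case: ifP => // _; case: ifP.
  - by rewrite r3 subnKC.
rewrite -[in RHS](subnKC imN) !path_costD.
rewrite (eq_path_cost r1) (eq_path_cost r2) (eq_path_cost (fun j _ => r3 j)).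
by rewrite -[(_ + _ + _)%R]addrA; ring.
Qed.

Variables (q : nat -> 'rV[R]_n) (N : nat).
Hypothesis qa : admissible V h M q N.
Hypothesis qmin : forall p N', admissible V h M p N' -> cost q N <= cost p N'.
Hypotheses (d0 : 0 < d) (e0 : 0 < e).

Lemma locally_minimal i m p m' : (i + m <= N)%N ->
  (forall j, `|p j| <= M) -> p 0%N = q i -> p m' = q (i + m)%N ->
  cost (fun k => q (i + k)%N) m <= cost p m'.
Proof.
move=> imN pM p0 pm; have [r [N' [ra rE]]] := splice qa imN pM p0 pm.
by have := qmin ra; rewrite rE; lra.
Qed.

(** Stopping at an earlier visit to {V >= h} would be admissible and save at least [d * e] for each
    dropped step. *)
Lemma min_path_inside i : (i < N)%N -> V (q i) < h.
Proof.
move=> iN; rewrite ltNge; apply/negP => hV.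
have [q0 qM qN] := qa.
have := qmin (And3 q0 qM hV); apply/negP; rewrite -ltNge.
rewrite -(subnKC (ltnW iN)) path_costD ltrDl.
apply: lt_le_trans (path_cost_ge V h e d0 (fun k => q (i + k)%N) (N - i)).
by rewrite mulr_gt0 ?mulr_gt0// ltr0n subn_gt0.
Qed.

(* Trading [m] steps for [m'] of them along the chord is the discrete substitute
   for a change of time; [m'] = [m] +- 1 yields conservation of energy. *)
Lemma chord_compare i m m' : (i + m <= N)%N -> (0 < m')%N ->
  let D := q (i + m)%N - q i in
  \sum_(j < m) (dotv (q (i + j).+1 - q (i + j)%N) (q (i + j).+1 - q (i + j)%N) / (2 * d)
       + d * (well V h (q (i + j)%N) + e)) <=
  dotv D D / (2 * d * m'%:R) +
  d * \sum_(j < m') (well V h (q i + (j%:R / m'%:R) *: D) + e).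
Proof.
move=> imN m'0.
(* Beyond [m'] the value [q i] is a default that keeps the sequence bounded by [M]. *)
set D := q (i + m)%N - q i; pose p j := if (j <= m')%N then q i + (j%:R / m'%:R) *: D else q i.
have [q0 qM qN] := qa.
have m'R : (m'%:R : R) != 0 by rewrite pnatr_eq0 -lt0n.
have pM j : `|p j| <= M.
  rewrite /p; case: ifP => // jm; set a := _ / _.
  have a0 : 0 <= a by rewrite divr_ge0.
  have a1 : a <= 1 by rewrite ler_pdivrMr ?ltr0n// mul1r ler_nat.
  (* Balls are convex, so the chord respects the bound [M]. *)
  have -> : q i + a *: D = (1 - a) *: q i + a *: q (i + m)%N.
    by rewrite /D scalerBr scalerBl scale1r addrA addrAC.
  have h1 : `|(1 - a) *: q i| <= (1 - a) * M.
    by rewrite normrZ ger0_norm ?subr_ge0// ler_wpM2l// subr_ge0.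
  have h2 : `|a *: q (i + m)%N| <= a * M by rewrite normrZ ger0_norm// ler_wpM2l.
  by apply: le_trans (ler_normD _ _) _; lra.
have p0 : p 0%N = q i by rewrite /p mul0r scale0r addr0.
have pm : p m' = q (i + m)%N by rewrite /p leqnn divff// scale1r subrKC.
have := locally_minimal imN pM p0 pm.
rewrite /path_cost /step_cost.
under eq_bigr do rewrite addnS.
move/le_trans; apply.
have -> : dotv D D / (2 * d * m'%:R) = \sum_(j < m') dotv D D / (2 * d * m'%:R ^+ 2).
  rewrite sumr_const card_ord -[RHS]mulr_natr; field.
  by rewrite m'R gt_eqF.
rewrite mulr_sumr -big_split/= ler_sum// => j _.
have jm : (j <= m')%N by apply: ltnW.
have -> : p j.+1 - p j = m'%:R^-1 *: D.
  rewrite /p jm ltn_ord opprD addrACA subrr add0r -scalerBl; congr (_ *: _).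
  by rewrite -mulrBl -natrB// subSnn mul1r.
rewrite dotvZl dotvZr /p jm le_eqVlt; apply/orP; left; apply/eqP.
congr (_ + _); field.
by rewrite m'R gt_eqF.
Qed.

End splice.

(** Testing against plus and minus the coordinate vectors, of sup norm at most 1, bounds every
    coordinate by [L], with no factor depending on the dimension. *)
Lemma clarke_grad_bounded (R : realType) n (V : 'rV[R]_n -> R) x y L : 0 <= L ->
  lipschitz_near V x L -> clarke_grad V x y -> `|y| <= L.
Proof.
move=> L0 VL yx; apply: norm_le_coord => // j; rewrite -(dotv_delta y).
have d1 : `|delta_mx ord0 j : 'rV[R]_n| <= 1.
  apply: norm_le_coord => // k; rewrite mxE; case: (_ && _) => /=; rewrite ?normr0//.
  by rewrite normr1.
have H v : `|v| <= 1 -> dotv y v <= L.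
  move=> v1; apply: le_trans (clarke_grad_le yx (lipschitz_near_bound v VL)) _.
  by rewrite -[leRHS]mulr1 ler_wpM2l.
by rewrite ler_norml lerNl -dotvNr !H// normrN.
Qed.

(** * Velocity bound and discrete Euler-Lagrange inclusion *)

Section discrete_euler_lagrange.
Context {R : realType} {n : nat}.
Variables (V : 'rV[R]_n -> R) (h M d e : R) (q : nat -> 'rV[R]_n) (N : nat).
Hypothesis Vc : continuous V.
Hypothesis VM : forall x, V x < h -> `|x| < M.
Hypothesis qa : admissible V h M q N.
Hypothesis qmin : forall p N', admissible V h M p N' ->
  path_cost V h d e q N <= path_cost V h d e p N'.
Hypothesis d0 : 0 < d.

Definition velocity (d : R) (q : nat -> 'rV[R]_n) i := d^-1 *: (q i.+1 - q i).

(** Replacing one step by two along the same chord lowers the kinetic term from |v|^2 / 2 to |v|^2 /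
    4 and adds at most [W + e] of potential and penalty; hence the factor 4. *)
Lemma velocity_bound W i : (forall x, `|x| <= M -> well V h x <= W) ->
  (i < N)%N -> dotv (velocity d q i) (velocity d q i) <= 4 * (W + e).
Proof.
move=> WM iN; have [q0 qM qN] := qa.
have i1N : (i + 1 <= N)%N by lia.
have := @chord_compare _ _ _ _ _ _ _ _ _ qa qmin d0 i 1 2 i1N isT.
rewrite !big_ord_recl !big_ord0/= !addn0 addn1 /velocity dotvZl dotvZr.
set D := q i.+1 - q i; rewrite !big_ord_recl big_ord0/= ?mulr0n mul0r scale0r !addr0 => H.
have : well V h (q i + (1 / 2) *: D) <= W.
  apply: WM; have -> : q i + (1 / 2) *: D = (1 / 2) *: q i + (1 / 2) *: q i.+1.
    by apply/rowP => j; rewrite /D !mxE; lra.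
  apply: le_trans (ler_normD _ _) _; rewrite !normrZ normr1 (@ger0_norm _ 2^-1) ?invr_ge0//.
  by have := qM i; have := qM i.+1; lra.
move: H; rewrite /bump/= addn0 => H Wm.
have E : dotv D D = d ^+ 2 * (d^-1 * (d^-1 * dotv D D)) by field; rewrite gt_eqF.
rewrite E in H; move: H; set S := d^-1 * _; set w1 := well _ _ _; set w2 := well _ _ _ in Wm *.
have -> : d ^+ 2 * S / (2 * d) = d * (S / 2) by field; rewrite gt_eqF.
have -> : d ^+ 2 * S / (2 * d * 2) = d * (S / 4) by field; rewrite gt_eqF.
rewrite -!mulrDr ler_pM2l//; lra.
Qed.

Hypothesis e0 : 0 < e.

Lemma minimal_two_steps i w : (i.+1 < N)%N -> `|w| <= M ->
  step_cost V h d e (q i) (q i.+1) + step_cost V h d e (q i.+1) (q i.+2) <=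
  step_cost V h d e (q i) w + step_cost V h d e w (q i.+2).
Proof.
move=> iN wM; have [q0 qM qN] := qa.
have i2N : (i + 2 <= N)%N by lia.
have := @locally_minimal _ _ _ _ _ _ _ _ _ qa qmin i 2
  (fun j => if j == 1%N then w else q (i + j)%N) 2 i2N.
rewrite /path_cost !big_ord_recl !big_ord0/= !addn0 addn1 addn2 !addr0; apply => // j.
by case: ifP.
Qed.

(** The vertex q_(i+1) is moved to w = q_(i+1) - t v. Moving it backwards makes it the far end of
    the quotient based at [w], so minimality bounds V(w + t v) - V(w) from below, as Clarke's upper
    limit requires. The kinetic terms give the second difference and an error of order t^2. *)
Lemma discrete_euler_lagrange i : (i.+1 < N)%N ->
  clarke_grad V (q i.+1) (- (d^-1 *: (velocity d q i.+1 - velocity d q i))).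
Proof.
move=> iN v; apply: le_clarke_dir => r e' r0 e'0.
set a := q i.+1 - q i; set b := q i.+2 - q i.+1.
have Vq : V (q i.+1) < h := min_path_inside qa qmin d0 e0 iN.
have Vt : V (q i.+1 - t *: v) @[t --> 0^'+] --> V (q i.+1).
  have qt : q i.+1 - t *: v @[t --> 0^'+] --> q i.+1.
    rewrite -[X in _ --> X]subr0; apply: (@cvgB _ _ _ (0 : R)^'+ _ (fun=> q i.+1)).
      exact: cvg_cst.
    rewrite -[X in _ --> X](scale0r v); apply: cvgZr_tmp.
    by apply: cvg_within_filter; exact: cvg_id.
  by apply: (@continuous_cvg _ _ _ _ _ _ _ _ _ qt); exact: Vc.
have Kpos : 0 < 1 + `|v| by rewrite ltr_wpDr.
have Dpos : 0 < 1 + dotv v v / d ^+ 2.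
  by rewrite ltr_wpDr// divr_ge0 ?dotv_ge0// sqr_ge0.
near (0 : R)^'+ => t.
have t0 : 0 < t by [].
have tr : t < r by near: t; exact: nbhs_right_lt.
have tv : t * (1 + `|v|) < r.
  by rewrite -ltr_pdivlMr//; near: t; apply: nbhs_right_lt; rewrite divr_gt0.
have tD : t * (1 + dotv v v / d ^+ 2) < e'.
  by rewrite -ltr_pdivlMr//; near: t; apply: nbhs_right_lt; rewrite divr_gt0.
(* The vertex lies in the open well, so for small [t] the moved one does too; this keeps it in the
   ball of radius [M] and removes the truncation in [well]. *)
have Vw : V (q i.+1 - t *: v) < h.
  by near: t; apply: cvgr_lt Vt _ _.
set w := q i.+1 - t *: v in Vw *.
exists w, t; split; [|by rewrite t0|].
  rewrite /w addrAC subrr add0r normrN normrZ gtr0_norm//; lra.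
have -> : w + t *: v = q i.+1 by rewrite subrK.
have := minimal_two_steps iN (ltW (VM Vw)).
rewrite /step_cost !well_inside//; last exact: (min_path_inside qa qmin d0 e0 (ltnW iN)).
rewrite -/a -/b; have -> : w - q i = a - t *: v by rewrite /w /a addrAC.
have -> : q i.+2 - w = b + t *: v by rewrite /w /b opprB addrCA addrC.
have -> : dotv (- (d^-1 *: (velocity d q i.+1 - velocity d q i))) v =
    - ((dotv b v - dotv a v) / d ^+ 2).
  rewrite /velocity -/a -/b -scalerBr scalerA dotvNl dotvZl dotvBl.
  by field; rewrite gt_eqF.
clearbody a b.
rewrite !dotvDr !dotvDl !dotvNr !dotvNl !dotvZr !dotvZl (dotvC v a) (dotvC v b).
set A := dotv a v; set B := dotv b v; set C := dotv v v in tD *.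
move=> H.
have : d * (V w - V (q i.+1)) <= (t * (B - A) + t ^+ 2 * C) / d.
  have -> : (t * (B - A) + t ^+ 2 * C) / d =
    (2 * (t * (B - A) + t ^+ 2 * C)) / (2 * d) by field; rewrite gt_eqF.
  move: H; rewrite -subr_ge0 => H; rewrite -subr_ge0; apply: le_trans H _.
  rewrite le_eqVlt; apply/orP; left; apply/eqP; field; rewrite gt_eqF//.
rewrite mulrC -ler_pdivlMr// => {}H.
have tD' : t * (C / d ^+ 2) <= e' by lra.
have E : (t * (B - A) + t ^+ 2 * C) / d / d = t * ((B - A) / d ^+ 2) + t * (t * (C / d ^+ 2)).
  by field; rewrite gt_eqF.
rewrite E in H; have := ler_wpM2l (ltW t0) tD'; nra.
Unshelve. all: by end_near. Qed.

Lemma velocity_step L i : 0 <= L -> (forall x, `|x| <= M -> lipschitz_near V x L) ->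
  (i.+1 < N)%N -> `|velocity d q i.+1 - velocity d q i| <= L * d.
Proof.
move=> L0 VL iN; have [q0 qM qN] := qa.
have := clarke_grad_bounded L0 (VL _ (qM i.+1)) (discrete_euler_lagrange iN).
by rewrite normrN normrZ gtr0_norm ?invr_gt0// ler_pdivrMl// mulrC.
Qed.

End discrete_euler_lagrange.

(** Discrete form of int <q'', q> = [<q', q>] - int |q'|^2; the boundary term at the start vanishes
    with [q 0]. *)
Lemma virial (R : realType) n (d : R) (q : nat -> 'rV[R]_n) k : d != 0 -> q 0%N = 0 ->
  \sum_(i < k) dotv (velocity d q i.+1 - velocity d q i) (q i.+1) =
  dotv (velocity d q k) (q k.+1) -
  d * \sum_(i < k.+1) dotv (velocity d q i) (velocity d q i).
Proof.
move=> d0 q0; have qS i : q i.+1 = q i + d *: velocity d q i.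
  by rewrite /velocity scalerA divff// scale1r subrKC.
elim: k => [|k IH]; first by rewrite big_ord0 big_ord1 qS q0 add0r dotvZr subrr.
rewrite big_ord_recr/= IH [in RHS]big_ord_recr/= (qS k.+1) dotvDr dotvZr dotvBl.
by ring.
Qed.

(** What the limit retains of minimality, with [C], [L] and [T] meant to be independent of the time
    step [d]. [orbit_chord] is the chord comparison divided by [d], with penalty [e = d]. *)
Record discrete_orbit {R : realType} {n : nat} (V : 'rV[R]_n -> R) (h M C L T d : R)
    (q : nat -> 'rV[R]_n) (N : nat) : Prop := DiscreteOrbit {
  orbit0 : q 0%N = 0 ;
  orbit_bounded : forall i, `|q i| <= M ;
  orbit_end : h <= V (q N) ;
  orbit_inside : forall i, (i < N)%N -> V (q i) < h ;
  orbit_time : N%:R * d <= T ;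
  orbit_velocity : forall i, (i < N)%N -> `|velocity d q i| <= C ;
  orbit_step : forall i, (i.+1 < N)%N -> `|velocity d q i.+1 - velocity d q i| <= L * d ;
  orbit_grad : forall i, (i.+1 < N)%N ->
    clarke_grad V (q i.+1) (- (d^-1 *: (velocity d q i.+1 - velocity d q i))) ;
  orbit_chord : forall i m m', (i + m <= N)%N -> (0 < m')%N ->
    \sum_(j < m) (dotv (velocity d q (i + j)) (velocity d q (i + j)) / 2 +
                   well V h (q (i + j)%N) + d) <=
    dotv (d^-1 *: (q (i + m)%N - q i)) (d^-1 *: (q (i + m)%N - q i)) / (2 * m'%:R) +
    \sum_(j < m') (well V h (q i + (j%:R / m'%:R) *: (q (i + m)%N - q i)) + d) }.

(** * Bounds independent of the time step *)

Section discrete_orbits.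
Context {R : realType} {n : nat}.
Variables (V : 'rV[R]_n -> R) (h mu1 mu2 M W L : R).
Hypothesis Vc : continuous V.
Hypothesis V0h : V 0 < h.
Hypothesis VM : forall x, V x < h -> `|x| < M.
Hypothesis mu1_gt0 : 0 < mu1.
Hypothesis V2 : forall q y, clarke_grad V q y -> mu1 * V q - mu2 <= dotv y q.
Hypothesis h_gt : mu2 < mu1 * h.
Hypothesis well_le : forall x, `|x| <= M -> well V h x <= W.
Hypothesis L0 : 0 <= L.
Hypothesis VL : forall x, `|x| <= M -> lipschitz_near V x L.

Let M0 : 0 <= M.
Proof. by have := VM V0h; rewrite normr0; exact: ltW. Qed.

Let W0 : 0 <= W.
Proof. by apply: le_trans (well_ge0 V h 0) (well_le _); rewrite normr0. Qed.

(** The segment from 0 to [x] run in unit time is a competitor whose cost is bounded independently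
    of [k]; the final 1 absorbs the penalty, as [d <= 1]. *)
Lemma straight_path_cost (x : 'rV[R]_n) k : `|x| <= M -> h <= V x ->
  let d := k.+1%:R^-1 in
  exists2 q, admissible V h M q k.+1 & path_cost V h d d q k.+1 <= dotv x x / 2 + W + 1.
Proof.
move=> xM hx d; have k0 : (k.+1%:R : R) != 0 by rewrite pnatr_eq0.
have d0 : 0 < d by rewrite invr_gt0.
have d1 : d <= 1 by rewrite invf_le1// ler1n.
pose q j : 'rV[R]_n := if (j <= k.+1)%N then (j%:R / k.+1%:R) *: x else 0.
have qM j : `|q j| <= M.
  rewrite /q; case: ifP => [jk|_]; last by rewrite normr0.
  rewrite normrZ ger0_norm ?divr_ge0// -[leRHS]mul1r ler_pM ?divr_ge0//.
  by rewrite ler_pdivrMr// mul1r ler_nat.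
exists q; first split => //.
- by rewrite /q mul0r scale0r.
- by rewrite /q leqnn divff// scale1r.
have kd : k.+1%:R * d = 1 by rewrite /d divff.
apply: (@le_trans _ _ (\sum_(i < k.+1) (d * (dotv x x / 2 + W + 1)))); last first.
  by rewrite sumr_const card_ord -[leLHS]mulr_natl mulrA kd mul1r.
apply: ler_sum => i _; rewrite /step_cost.
have -> : q i.+1 - q i = d *: x.
  rewrite /q ltn_ord (ltnW (ltn_ord i)) -scalerBl -mulrBl -natrB// subSnn.
  by rewrite mul1r.
rewrite dotvZl dotvZr -[in leRHS]addrA [leRHS]mulrDr.
have -> : d * (d * dotv x x) / (2 * d) = d * (dotv x x / 2) by field; rewrite gt_eqF.
by rewrite lerD2l ler_pM2l// lerD// well_le.
Qed.

Section time_bound.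
Variables (d A C : R) (q : nat -> 'rV[R]_n) (N : nat).
Hypotheses (d0 : 0 < d) (q0 : q 0%N = 0).
Hypothesis qM : forall i, `|q i| <= M.
Hypothesis qin : forall i, (i < N.+1)%N -> V (q i) < h.
Hypothesis qC : forall i, (i < N.+1)%N -> `|velocity d q i| <= C.
Hypothesis qgrad : forall i, (i < N)%N ->
    clarke_grad V (q i.+1) (- (d^-1 *: (velocity d q i.+1 - velocity d q i))).
Hypothesis qcost : path_cost V h d d q N.+1 <= A.

(* Summing <q'', q> by parts and using (V2) bounds the time by the action. *)
Lemma time_bound :
  N%:R * d * (mu1 * h - mu2) <= (mu1 + 2) * A + n%:R * (C * M).
Proof.
set v := velocity d q.
have dn0 : d != 0 by rewrite gt_eqF.
pose K := \sum_(i < N.+1) dotv (v i) (v i).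
pose P := \sum_(i < N.+1) well V h (q i).
have K0 : 0 <= K by apply: sumr_ge0 => i _; exact: dotv_ge0.
have P0 : 0 <= P by apply: sumr_ge0 => i _; exact: well_ge0.
have KP : d * K / 2 + d * P <= A.
  apply: le_trans qcost; rewrite /path_cost -mulrA (mulrC K) mulrA !mulr_sumr -big_split/=.
  apply: ler_sum => i _; rewrite /step_cost.
  have -> : q i.+1 - q i = d *: v i by rewrite /v /velocity scalerA divff// scale1r.
  rewrite (dotvZl d) (dotvZr d) mulrDr addrA.
  have -> : d * (d * dotv (v i) (v i)) / (2 * d) = d / 2 * dotv (v i) (v i) by field.
  by rewrite lerDl mulr_ge0// ltW.
have vir := virial N dn0 q0; rewrite -/v -/K in vir.
(* (V2) applied to the Euler-Lagrange inclusion, with V = h - [well] at interior vertices. *)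
have H : \sum_(i < N) dotv (v i.+1 - v i) (q i.+1) <=
    \sum_(i < N) (d * mu1 * well V h (q i.+1) - d * (mu1 * h - mu2)).
  apply: ler_sum => i _.
  have := V2 (qgrad (ltn_ord i)); rewrite -/v dotvNl dotvZl well_inside ?qin ?ltnS//.
  rewrite lerNr ler_pdivrMl//; lra.
have PS : \sum_(i < N) well V h (q i.+1) <= P.
  by rewrite /P big_ord_recl lerDr well_ge0.
rewrite big_split/= -mulr_sumr sumr_const card_ord -[(- _) *+ N]mulr_natl in H.
have B : - (n%:R * (C * M)) <= dotv (v N) (q N.+1).
  have : `|dotv (v N) (q N.+1)| <= n%:R * (C * M).
    by apply: le_trans (dotv_le _ _) _; rewrite ler_wpM2l// ler_pM// qC.
  by rewrite ler_norml => /andP[].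
have dm : 0 < d * mu1 by rewrite mulr_gt0.
have PS' : d * mu1 * (\sum_(i < N) well V h (q i.+1)) <= d * mu1 * P by rewrite ler_pM2l.
(* In the factor [mu1 + 2], [mu1] pays for the potential part of the action and 2 for the kinetic
   part, which enters the action halved. *)
have A1 : mu1 * (d * P) <= mu1 * A.
  by rewrite ler_pM2l//; have := mulr_ge0 (ltW d0) K0; lra.
have A2 : d * K <= 2 * A by have := mulr_ge0 (ltW d0) P0; lra.
rewrite vir in H; lra.
Qed.
End time_bound.

Lemma discrete_orbit_exists (x : 'rV[R]_n) : `|x| <= M -> h <= V x ->
  exists C T, forall k, exists q N, discrete_orbit V h M C L T k.+1%:R^-1 q N.
Proof.
move=> xM hx; have W0' := W0; have V0' := V0h.
(* [C] bounds the squared velocity because [d <= 1], and the velocity itself because [C >= 1]. *)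
pose C := 4 * (W + 1); pose A := dotv x x / 2 + W + 1.
have c0 : 0 < mu1 * h - mu2 by rewrite subr_gt0.
(* [time_bound] counts all steps but the last; the added 1 covers that one. *)
pose T := ((mu1 + 2) * A + n%:R * (C * M)) / (mu1 * h - mu2) + 1.
exists C, T => k; set d := k.+1%:R^-1.
have d0 : 0 < d by rewrite invr_gt0.
have d1 : d <= 1 by rewrite invf_le1// ler1n.
have C1 : 1 <= C by rewrite /C; lra.
have [p pa pA] := straight_path_cost k xM hx.
have [q [N [qa qmin]]] := min_path Vc d0 d0 pa.
have [q0 qM qN] := qa.
have qin := min_path_inside qa qmin d0 d0.
have qC i : (i < N)%N -> `|velocity d q i| <= C.
  move=> iN; apply: norm_le_of_dotv; first lra.
  apply: le_trans (velocity_bound qa qmin d0 well_le iN) _.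
  apply: (@le_trans _ _ C); first by rewrite /C; lra.
  by rewrite expr2 ler_peMl//; lra.
have qE := @discrete_euler_lagrange _ _ _ _ _ _ _ _ _ Vc VM qa qmin d0 d0.
exists q, N; split => //.
- have : (0 < N)%N.
    by rewrite lt0n; apply/eqP => N0; move: qN; rewrite N0 q0; lra.
  case: N qa qmin qN qin qC qE => // N qa qmin qN qin qC qE _.
  have := time_bound d0 q0 qM qin qC qE (le_trans (qmin _ _ pa) pA).
  have -> : N.+1%:R * d = N%:R * d + d by rewrite -[N.+1]addn1 natrD mulrDl mul1r.
  rewrite -ler_pdivlMr// /T => H.
  by rewrite lerD.
- by move=> i iN; apply: (velocity_step Vc VM qa qmin d0 d0 L0 VL).
- move=> i m m' im m'0; rewrite -(ler_pM2l d0).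
  have m'R : (m'%:R : R) != 0 by rewrite pnatr_eq0 -lt0n.
  have := chord_compare qa qmin d0 im m'0; congr (_ <= _).
    rewrite mulr_sumr; apply: eq_bigr => j _; rewrite /velocity dotvZl dotvZr.
    by field; rewrite gt_eqF.
  rewrite mulrDr; congr (_ + _); rewrite dotvZl dotvZr; field.
  by rewrite m'R gt_eqF.
Qed.
End discrete_orbits.

(** * Limits of minimal discrete paths *)

Lemma ultra_fmap (S T : Type) (f : S -> T) (U : set_system S) :
  UltraFilter U -> UltraFilter (f @ U).
Proof.
move=> UU; split; first exact: fmap_proper_filter.
move=> G PG fG; apply/seteqP; split => // A GA.
case: (in_ultra_setVsetC (f @^-1` A) UU) => // UA.
have GC : G (~` A) by exact: fG.
by exfalso; apply: (@filter_not_empty _ G); rewrite -(setICr A); exact: filterI.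
Qed.

Lemma ultra_bounded_cvg (R : realType) n (U : set_system nat) (f : nat -> 'rV[R]_n) (B : R) :
  UltraFilter U -> (forall k, `|f k| <= B) -> exists l : 'rV[R]_n, f @ U --> l.
Proof.
move=> UU fB.
have := @norm_ball_compact R n B; rewrite compact_ultra => /(_ (f @ U)).
case; first exact: ultra_fmap.
- by apply: nearW => k; exact: fB.
- by move=> l [_ fl]; exists l.
Qed.

Lemma ultra_bounded_cvgR (R : realType) (U : set_system nat) (f : nat -> R) (B : R) :
  UltraFilter U -> (forall k, `|f k| <= B) -> exists l : R, f @ U --> l.
Proof.
move=> UU fB; have := @segment_compact R (- B) B; rewrite compact_ultra => /(_ (f @ U)).
case; first exact: ultra_fmap.
- by apply: nearW => k; rewrite /= in_itv/= -ler_norml.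
- by move=> l [_ fl]; exists l.
Qed.

Lemma velocity_sum (R : realType) n (d : R) (q : nat -> 'rV[R]_n) i m :
  \sum_(j < m) velocity d q (i + j)%N = d^-1 *: (q (i + m)%N - q i).
Proof.
elim: m => [|m IH]; first by rewrite big_ord0 addn0 subrr scaler0.
by rewrite big_ord_recr/= IH /velocity -scalerDr addrC subrKA addnS.
Qed.

(** * Lipschitz, Taylor and gradient estimates on a discrete orbit *)

Section discrete_estimates.
Context {R : realType} {n : nat}.
Variables (V : 'rV[R]_n -> R) (h M C L T d : R) (q : nat -> 'rV[R]_n) (N : nat).
Hypothesis d0 : 0 < d.
Hypothesis qo : discrete_orbit V h M C L T d q N.
Local Notation v := (velocity d q).

Let qS i : q i.+1 = q i + d *: v i.
Proof. by rewrite /velocity scalerA divff ?gt_eqF// scale1r subrKC. Qed.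

Lemma orbit_position_lip i m : (i + m <= N)%N -> `|q (i + m)%N - q i| <= C * (m%:R * d).
Proof.
elim: m => [|m IH] imN; first by rewrite addn0 subrr normr0 mul0r mulr0.
rewrite addnS qS addrAC; apply: le_trans (ler_normD _ _) _.
have IH' := IH (leq_trans (leq_add (leqnn i) (leqnSn m)) imN).
have : `|d *: v (i + m)%N| <= C * d.
  by rewrite normrZ gtr0_norm// mulrC ler_pM2r// (orbit_velocity qo)// -addnS.
by move=> H; rewrite -natr1; lra.
Qed.

Lemma orbit_velocity_lip i m : 0 <= L -> (i + m < N)%N -> `|v (i + m)%N - v i| <= L * (m%:R * d).
Proof.
move=> L0; elim: m => [|m IH] imN; first by rewrite addn0 subrr normr0 mul0r mulr0.
rewrite addnS -(subrKA (v (i + m)%N)); apply: le_trans (ler_normD _ _) _.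
have := IH (leq_ltn_trans (leq_add (leqnn i) (leqnSn m)) imN).
rewrite addnS in imN.
by have := orbit_step qo imN => H1 H2; rewrite -natr1; lra.
Qed.

(** Each further step adds an error of at most L m d^2, and m^2 + m <= (m + 1)^2. The constant is
    not sharp; the quadratic order is what identifies the derivative in the limit. *)
Lemma orbit_taylor_right i m : 0 <= L -> (i + m <= N)%N -> (i < N)%N ->
  `|q (i + m)%N - q i - (m%:R * d) *: v i| <= L * (m%:R * d) ^+ 2.
Proof.
move=> L0; elim: m => [|m IH] imN iN.
  by rewrite addn0 subrr mul0r scale0r subr0 normr0 expr2 !mulr0.
have {}IH := IH (leq_trans (leq_add (leqnn i) (leqnSn m)) imN) iN.
have -> : q (i + m.+1)%N - q i - (m.+1%:R * d) *: v i =
   (q (i + m)%N - q i - (m%:R * d) *: v i) + d *: (v (i + m)%N - v i).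
  rewrite addnS qS -natr1 mulrDl mul1r scalerDl scalerBr.
  by apply/rowP => j; rewrite !mxE; lra.
apply: le_trans (ler_normD _ _) _.
have imN' : (i + m < N)%N by rewrite -addnS.
have := orbit_velocity_lip L0 imN'; rewrite -(ler_pM2l d0) => H.
rewrite normrZ gtr0_norm// -natr1.
have m0 : 0 <= m%:R :> R by [].
have : 0 <= L * (d * d) by rewrite !mulr_ge0// ltW.
by nra.
Qed.

Lemma orbit_taylor_left j m : 0 <= L -> (j + m < N)%N ->
  `|q j - q (j + m)%N + (m%:R * d) *: v (j + m)%N| <= L * (m%:R * d) ^+ 2.
Proof.
move=> L0; elim: m j => [|m IH] j jmN.
  by rewrite addn0 subrr mul0r scale0r addr0 normr0 expr2 !mulr0.
have {}IH := IH j.+1; rewrite addSnnS in IH; have {}IH := IH jmN.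
have -> : q j - q (j + m.+1)%N + (m.+1%:R * d) *: v (j + m.+1)%N =
   (q j.+1 - q (j + m.+1)%N + (m%:R * d) *: v (j + m.+1)%N) + d *: (v (j + m.+1)%N - v j).
  rewrite qS -natr1 mulrDl mul1r scalerDl scalerBr.
  by apply/rowP => i; rewrite !mxE; lra.
apply: le_trans (ler_normD _ _) _.
have := orbit_velocity_lip L0 jmN; rewrite -(ler_pM2l d0) => H.
rewrite normrZ gtr0_norm// -natr1; rewrite -natr1 in H.
have m0 : 0 <= m%:R :> R by [].
have : 0 <= L * (d * d) by rewrite !mulr_ge0// ltW.
by nra.
Qed.

Lemma orbit_position_dist i j : (i <= N)%N -> (j <= N)%N ->
  `|q i - q j| <= C * `|i%:R * d - j%:R * d|.
Proof.
wlog ij : i j / (j <= i)%N => [H iN jN|iN _].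
  have [/H|/ltnW/H] := leqP j i; first exact.
  by rewrite distrC (distrC (i%:R * d)); apply.
rewrite -(subnKC ij) natrD mulrDl addrAC subrr add0r [X in _ * X]ger0_norm ?mulr_ge0 ?(ltW d0)//.
by apply: orbit_position_lip; rewrite subnKC.
Qed.

Lemma orbit_velocity_dist i j : 0 <= L -> (i < N)%N -> (j < N)%N ->
  `|v i - v j| <= L * `|i%:R * d - j%:R * d|.
Proof.
move=> L0; wlog ij : i j / (j <= i)%N => [H iN jN|iN _].
  have [/H|/ltnW/H] := leqP j i; first exact.
  by rewrite distrC (distrC (i%:R * d)); apply.
rewrite -(subnKC ij) natrD mulrDl addrAC subrr add0r [X in _ * X]ger0_norm ?mulr_ge0 ?(ltW d0)//.
by apply: orbit_velocity_lip => //; rewrite subnKC.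
Qed.

Lemma orbit_taylor i j : 0 <= L -> (i < N)%N -> (j <= N)%N ->
  `|q j - q i - (j%:R * d - i%:R * d) *: v i| <= L * (j%:R * d - i%:R * d) ^+ 2.
Proof.
move=> L0 iN jN; have [ij|/ltnW ji] := leqP i j.
  rewrite -(subnKC ij) natrD mulrDl [X in X *: _]addrAC subrr add0r.
  rewrite [X in X ^+ 2]addrAC subrr add0r.
  by apply: orbit_taylor_right => //; rewrite subnKC.
have := @orbit_taylor_left j (i - j) L0; rewrite subnKC// => /(_ iN).
rewrite natrB// mulrBl -[X in _ + X *: _]opprB scaleNr.
by rewrite -[_ * _ - _ as X in X ^+ 2]opprB sqrrN.
Qed.

(** Summing the inclusions tested against [u] gives an integrated inclusion, which passes to the
    limit although second differences over [d] need not converge. *)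
Lemma orbit_gradient_sum i m u b : (i + m < N)%N ->
  (forall l, (i < l <= i + m)%N -> clarke_bound V (q l) u b) ->
  dotv (- (v (i + m)%N - v i)) u <= b * (m%:R * d).
Proof.
elim: m => [|m IH] imN H; first by rewrite addn0 subrr oppr0 dotv0l mul0r mulr0.
rewrite addnS in imN H *.
have {}IH : dotv (- (v (i + m)%N - v i)) u <= b * (m%:R * d).
  by apply: IH; [exact: ltnW|move=> l li; apply: H; lia].
have bl : clarke_bound V (q (i + m).+1) u b by apply: H; lia.
have := clarke_grad_le (orbit_grad qo imN) bl.
rewrite -scalerN dotvZl mulrC ler_pdivrMr// => H1.
rewrite -(subrKA (v (i + m)%N)) opprD dotvDl -natr1; lra.
Qed.

End discrete_estimates.

(** The Taylor clause encodes q' = v up to the endpoints. The gradient clause is the inclusion in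
    integrated form; it yields the pointwise inclusion wherever [v] is differentiable. *)
Record energy_arc {R : realType} {n : nat} (V : 'rV[R]_n -> R) (h L T : R)
    (q v : R -> 'rV[R]_n) : Prop := EnergyArc {
  energy_arc_lip : forall s t : R, 0 <= s <= T -> 0 <= t <= T ->
    `|v t - v s| <= L * `|t - s| ;
  energy_arc_taylor : forall s t : R, 0 <= s <= T -> 0 <= t <= T ->
    `|q t - q s - (t - s) *: v s| <= L * (t - s) ^+ 2 ;
  energy_arcE : forall t : R, 0 <= t <= T -> dotv (v t) (v t) / 2 + V (q t) = h ;
  energy_arc_gradient : forall (t : R) u b, 0 <= t <= T -> clarke_bound V (q t) u b ->
    exists2 r, 0 < r & forall s1 s2 : R, 0 <= s1 -> s1 <= s2 -> s2 <= T ->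
      `|s1 - t| < r -> `|s2 - t| < r -> dotv (- (v s2 - v s1)) u <= b * (s2 - s1) }.

Record brake_arc {R : realType} {n : nat} (V : 'rV[R]_n -> R) (h L T : R)
    (q v : R -> 'rV[R]_n) : Prop := BrakeArc {
  arc_time : 0 < T ;
  arc_start : q 0 = 0 ;
  arc_end : V (q T) = h ;
  arc_energy_arc : energy_arc V h L T q v }.

Lemma cvg_close (R : realType) n (U : set_system nat) {FU : Filter U}
    (f g : nat -> 'rV[R]_n) (e : nat -> R) (l : 'rV[R]_n) :
  f @ U --> l -> e @ U --> 0 -> (\forall k \near U, `|g k - f k| <= e k) -> g @ U --> l.
Proof.
move=> fl e0 fge; apply/cvgrPdist_lt => /= r r0; have r2 : 0 < r / 2 by rewrite divr_gt0.
near=> k.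
have : `|l - f k| < r / 2 by near: k; move: r2; apply: cvgr_dist_lt fl _.
have : e k < r / 2 by near: k; apply: (cvgr_lt _ e0); rewrite divr_gt0.
have : `|g k - f k| <= e k by near: k.
have := ler_normB (l - f k) (g k - f k); rewrite opprB addrA subrK.
rewrite [r in _ -> _ -> _ -> _ -> _ < r]splitr; lra.
Unshelve. all: by end_near. Qed.

(** * Passage to the limit along an ultrafilter *)

Section limit_arc.
Context {R : realType} {n : nat}.
Variables (V : 'rV[R]_n -> R) (h M C L Tm : R).
Variables (q : nat -> nat -> 'rV[R]_n) (N : nat -> nat) (U : set_system nat).
Implicit Types (s t b r : R) (u : 'rV[R]_n) (i m : nat).
Hypothesis Vc : continuous V.
Hypothesis V0h : V 0 < h.
Hypothesis L0 : 0 <= L.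
Hypothesis UU : UltraFilter U.
Hypothesis Uoo : \oo `<=` U.
Local Notation d k := (k.+1%:R^-1 : R).
Local Notation v k := (velocity (d k) (q k)).
Hypothesis qo : forall k, discrete_orbit V h M C L Tm (d k) (q k) (N k).

Let d0 k : 0 < d k. Proof. by rewrite invr_gt0. Qed.

Let dcvg : (fun k => d k) @ U --> (0 : R).
Proof.
apply/cvgrPdist_lt => e e0; apply: Uoo.
have := near_infty_natSinv_lt (PosNum e0); apply: filterS => k /=.
by rewrite sub0r normrN gtr0_norm.
Qed.

Let N_gt0 k : (0 < N k)%N.
Proof.
have := orbit_end (qo k); case: (N k) => // hV.
by move: V0h; rewrite -(orbit0 (qo k)) ltNge hV.
Qed.

Variable T : R.
Hypothesis NT : (fun k => (N k)%:R * d k) @ U --> T.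

Let T_ge0 : 0 <= T.
Proof.
apply: (@ler_cvg_to _ U _ _ (fun=> 0) _ _ _ _ NT); first exact: cvg_cst.
by apply: nearW => k; rewrite mulr_ge0// ltW.
Qed.

(* The clamp at [N k - c] leaves [c] further steps available after [idx c t k]. *)
Let idx (c : nat) (t : R) k : nat := minn (Num.truncn (t / d k)) (N k - c).

Let idx_le c t k : (idx c t k <= N k - c)%N.
Proof. exact: geq_minr. Qed.

Let idx_mono c s t k : s <= t -> (idx c s k <= idx c t k)%N.
Proof.
move=> st; rewrite /idx leq_min geq_minr andbT.
apply: leq_trans (geq_minl _ _) _; apply: le_truncn.
by rewrite ler_pM2r// invr_gt0.
Qed.

Let idx_cvg c t : 0 <= t <= T -> (fun k => (idx c t k)%:R * d k) @ U --> t.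
Proof.
move=> /andP[t0 tT]; apply/cvgrPdist_le => /= e e0.
(* Three errors: rounding [t] down to the grid, the [c] steps lost to the clamp, and the distance
   from the discrete duration to [T]. *)
have e3 : 0 < e / 3 by rewrite divr_gt0.
have c1 : 0 < (c.+1%:R : R) by [].
near=> k.
have dk : d k < e / 3 / c.+1%:R.
  by near: k; apply: (cvgr_lt _ dcvg); rewrite divr_gt0.
have Nk : `|T - (N k)%:R * d k| < e / 3 by near: k; move: e3; apply: cvgr_dist_lt NT _.
move: dk; rewrite ltr_pdivlMr// => dk.
have dk0 := d0 k.
have cd : c%:R * d k < e / 3.
  by apply: le_lt_trans dk; rewrite mulrC ler_pM2l// ler_nat.
have d1 : d k < e / 3.
  by apply: le_lt_trans dk; rewrite -[leLHS]mulr1 ler_pM2l// ler1n.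
have /andP[] := @truncn_itv _ (t / d k) (divr_ge0 t0 (ltW dk0)).
rewrite ler_pdivlMr// ltr_pdivrMr// -[(Num.truncn _).+1%:R]natr1 mulrDl mul1r => fl fu.
have Nc : (N k)%:R * d k - c%:R * d k <= (N k - c)%:R * d k.
  rewrite -mulrBl ler_pM2r//; have [cN|Nc] := leqP c (N k); first by rewrite natrB.
  by apply: (@le_trans _ _ 0) => //; rewrite subr_le0 ler_nat ltnW.
have Nc' : (N k - c)%:R * d k <= (N k)%:R * d k.
  by rewrite ler_pM2r// ler_nat leq_subr.
have ->: (idx c t k)%:R * d k = Num.min ((Num.truncn (t / d k))%:R * d k) ((N k - c)%:R * d k).
  by rewrite /idx natr_min minr_pMl// ltW.
move: Nk; rewrite ltr_norml => /andP[N1 N2].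
move: (Num.truncn _)%:R (N k)%:R (N k - c)%:R fl fu Nc Nc' N1 N2 => x y z fl fu Nc Nc' N1 N2.
move: (k.+1%:R^-1) dk0 d1 cd fl fu Nc Nc' N1 N2 => D dk0 d1 cd fl fu Nc Nc' N1 N2.
by have [xy|yx] := leP (x * D) (z * D); rewrite ler_norml; apply/andP; split; lra.
Unshelve. all: by end_near. Qed.

Variables (Q P : R -> 'rV[R]_n).
Hypothesis Qcvg : forall t, (fun k => q k (idx 0 t k)) @ U --> Q t.
Hypothesis Pcvg : forall t, (fun k => v k (idx 1 t k)) @ U --> P t.

Let dist_cvg (B t : R) (a b : nat -> nat) :
  (fun k => (a k)%:R * d k) @ U --> t -> (fun k => (b k)%:R * d k) @ U --> t ->
  (fun k => B * `|(a k)%:R * d k - (b k)%:R * d k|) @ U --> (0 : R).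
Proof.
move=> at_ bt; rewrite -(mulr0 B); apply: cvgMl_tmp.
rewrite -(normr0 R) -(subrr t); apply: cvg_norm.
exact: cvgB.
Qed.

(** Discrete positions are Lipschitz uniformly in [k], so the limit depends only on the limiting
    time and not on the chosen indices. *)
Let Qlim (i : nat -> nat) (t : R) : 0 <= t <= T -> (\forall k \near U, (i k <= N k)%N) ->
  (fun k => (i k)%:R * d k) @ U --> t -> (fun k => q k (i k)) @ U --> Q t.
Proof.
move=> tT iN it; apply: (@cvg_close _ _ U _ _ _ _ _ (@Qcvg t) (dist_cvg C it (idx_cvg 0 tT))).
apply: filterS iN => k iN; apply: (orbit_position_dist (d0 k) (qo k)) => //.
by apply: leq_trans (idx_le _ _ _) _; rewrite subn0.
Qed.

Let Plim (i : nat -> nat) (t : R) : 0 <= t <= T -> (\forall k \near U, (i k < N k)%N) ->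
  (fun k => (i k)%:R * d k) @ U --> t -> (fun k => v k (i k)) @ U --> P t.
Proof.
move=> tT iN it; apply: (@cvg_close _ _ U _ _ _ _ _ (@Pcvg t) (dist_cvg L it (idx_cvg 1 tT))).
apply: filterS iN => k iN; apply: (orbit_velocity_dist (d0 k) (qo k)) => //.
by apply: leq_ltn_trans (idx_le _ _ _) _; rewrite subn1 prednK.
Qed.

Let idx0_le t k : (idx 0 t k <= N k)%N.
Proof. by apply: leq_trans (idx_le _ _ _) _; rewrite subn0. Qed.

Let idx1_lt t k : (idx 1 t k < N k)%N.
Proof. by apply: leq_ltn_trans (idx_le _ _ _) _; rewrite subn1 prednK. Qed.

Let TT : 0 <= T <= T. Proof. by rewrite T_ge0 lexx. Qed.
Let T00 : 0 <= (0 : R) <= T. Proof. by rewrite T_ge0 lexx. Qed.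

Let Q0 : Q 0 = 0.
Proof.
have : (fun k => q k 0%N) @ U --> Q 0.
  apply: Qlim => //; first exact: nearW.
  by under eq_fun do rewrite mul0r; exact: cvg_cst.
have -> : (fun k => q k 0%N) = (fun=> 0) by apply/funext => k; exact: orbit0 (qo k).
move=> H; apply: (cvg_unique (@norm_hausdorff _ _) H); exact: cvg_cst.
Qed.

Let V_cvg (x : nat -> 'rV[R]_n) l : x @ U --> l -> (fun k => V (x k)) @ U --> V l.
Proof. by move=> xl; apply: (@continuous_cvg _ _ _ _ _ _ _ _ _ xl); exact: Vc. Qed.

Let QT_ge : h <= V (Q T).
Proof.
have QT : (fun k => q k (N k)) @ U --> Q T by apply: Qlim => //; exact: nearW.
apply: (@ler_cvg_to _ U _ _ (fun=> h) _ _ _ _ (V_cvg QT)); first exact: cvg_cst.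
by apply: nearW => k; exact: orbit_end (qo k).
Qed.

Let Q_le t : 0 <= t <= T -> V (Q t) <= h.
Proof.
move=> tT.
have Qt : (fun k => q k (idx 1 t k)) @ U --> Q t.
  by apply: Qlim => //; [apply: nearW => k; exact: ltnW|exact: idx_cvg].
apply: (@ler_cvg_to _ U _ _ _ (fun=> h) _ _ (V_cvg Qt)); first exact: cvg_cst.
by apply: nearW => k; apply/ltW/(orbit_inside (qo k)).
Qed.

Let T_gt0 : 0 < T.
Proof.
rewrite lt_neqAle T_ge0 andbT; apply/eqP => T0.
by have := QT_ge; rewrite -T0 Q0 leNgt V0h.
Qed.

Let P_lip s t : 0 <= s <= T -> 0 <= t <= T -> `|P t - P s| <= L * `|t - s|.
Proof.
move=> sT tT; have st : (fun k => `|v k (idx 1 t k) - v k (idx 1 s k)|) @ U --> `|P t - P s|.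
  by apply: cvg_norm; exact: cvgB (@Pcvg t) (@Pcvg s).
apply: (@ler_cvg_to nat U _ R _ _ _ _ st).
  apply: cvgMl_tmp; apply: cvg_norm; apply: cvgB; apply: (@idx_cvg 1); [exact: tT|exact: sT].
by apply: nearW => k; apply: (orbit_velocity_dist (d0 k) (qo k)).
Qed.

Let Q_lip s t : 0 <= s <= T -> 0 <= t <= T -> `|Q t - Q s| <= C * `|t - s|.
Proof.
move=> sT tT; have st : (fun k => `|q k (idx 0 t k) - q k (idx 0 s k)|) @ U --> `|Q t - Q s|.
  by apply: cvg_norm; exact: cvgB (@Qcvg t) (@Qcvg s).
apply: (@ler_cvg_to nat U _ R _ _ _ _ st).
  apply: cvgMl_tmp; apply: cvg_norm; apply: cvgB; apply: (@idx_cvg 0); [exact: tT|exact: sT].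
by apply: nearW => k; apply: (orbit_position_dist (d0 k) (qo k)).
Qed.

Let Q_taylor s t : 0 <= s <= T -> 0 <= t <= T ->
  `|Q t - Q s - (t - s) *: P s| <= L * (t - s) ^+ 2.
Proof.
move=> sT tT.
have Qs : (fun k => q k (idx 1 s k)) @ U --> Q s.
  by apply: Qlim => //; [apply: nearW => k; exact: ltnW|exact: idx_cvg].
have ts : (fun k => (idx 0 t k)%:R * d k - (idx 1 s k)%:R * d k) @ U --> t - s.
  exact: cvgB (idx_cvg 0 tT) (idx_cvg 1 sT).
have st : (fun k => `|q k (idx 0 t k) - q k (idx 1 s k) -
    ((idx 0 t k)%:R * d k - (idx 1 s k)%:R * d k) *: v k (idx 1 s k)|) @ U -->
    `|Q t - Q s - (t - s) *: P s|.
  by apply: cvg_norm; apply: cvgB; [exact: cvgB (@Qcvg t) Qs|exact: cvgZ ts (@Pcvg s)].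
apply: (@ler_cvg_to nat U _ R _ _ _ _ st).
  by apply: cvgMl_tmp; rewrite expr2; apply: cvgM; exact: ts.
by apply: nearW => k /=; apply: (orbit_taylor (d0 k) (qo k)).
Qed.

Let shift_cvg (i : nat -> nat) (t : R) j : (fun k => (i k)%:R * d k) @ U --> t ->
  (fun k => (i k + j)%:R * d k) @ U --> t.
Proof.
move=> it; have -> : (fun k => (i k + j)%:R * d k) = (fun k => (i k)%:R * d k + j%:R * d k).
  by apply/funext => k; rewrite natrD mulrDl.
rewrite -[X in _ --> X]addr0; apply: cvgD => //.
by rewrite -(mulr0 j%:R); apply: cvgMl_tmp.
Qed.

Let N_ge m : \forall k \near U, (m <= N k)%N.
Proof.
have T2 : 0 < T / 2 by rewrite divr_gt0.
have m1 : 0 < (m.+1%:R : R) by [].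
near=> k.
have : d k < T / 2 / m.+1%:R.
  by near: k; apply: (cvgr_lt _ dcvg); rewrite divr_gt0.
have : T / 2 < (N k)%:R * d k.
  by near: k; apply: (cvgr_gt _ NT); lra.
move=> H1 H2; rewrite ltr_pdivlMr// mulrC in H2.
by have := lt_trans H2 H1; rewrite ltr_pM2r// ltr_nat => /ltnW/ltnW.
Unshelve. all: by end_near. Qed.

(** Here [m] and [m'] stay fixed while [d] tends to 0: all vertices involved collapse to [Q t],
    their velocities to [P t], and the chord divided by [d] tends to m P(t). *)
Let energy_chord t m m' : 0 <= t <= T -> (0 < m')%N ->
  let E := dotv (P t) (P t) / 2 in let w := well V h (Q t) in
  m%:R * (E + w) <= m%:R ^+ 2 * E / m'%:R + m'%:R * w.
Proof.
move=> tT m'0; set E := _ / 2; set w := well V h (Q t); pose i := idx m t.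
have im : \forall k \near U, (i k + m <= N k)%N.
  by apply: filterS (N_ge m) => k mN; have := idx_le m t k; rewrite /i; lia.
have it := idx_cvg m tT.
have Pj (j : 'I_m) : (fun k => v k (i k + j)%N) @ U --> P t.
  apply: Plim => //; last exact: shift_cvg.
  by apply: filterS im => k; apply: leq_trans; rewrite ltn_add2l.
have Qj (j : nat) : (j <= m)%N -> (fun k => q k (i k + j)%N) @ U --> Q t.
  move=> jm; apply: Qlim => //; last exact: shift_cvg.
  by apply: filterS im => k; apply: leq_trans; rewrite leq_add2l.
have Q00 : (fun k => q k (i k)) @ U --> Q t.
  by have := Qj 0%N isT; under eq_fun do rewrite addn0.
have well_cvg (x : nat -> 'rV[R]_n) l : x @ U --> l -> (fun k => well V h (x k)) @ U --> well V h l.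
  by move=> xl; apply: (@continuous_cvg _ _ _ _ _ _ _ _ _ xl); exact: well_continuous.
have DP : (fun k => (d k)^-1 *: (q k (i k + m)%N - q k (i k))) @ U --> m%:R *: P t.
  under eq_fun do rewrite -velocity_sum.
  have -> : m%:R *: P t = \sum_(j < m) P t by rewrite sumr_const card_ord scaler_nat.
  exact: cvg_sumr.
have lhs : (fun k => \sum_(j < m) (dotv (v k (i k + j)) (v k (i k + j)) / 2 +
     well V h (q k (i k + j)%N) + d k)) @ U --> \sum_(j < m) (E + w + 0).
  apply: cvg_sumr => j; apply: cvgD => //; apply: cvgD.
    by apply: cvgMr_tmp; apply: dotv_cvg; exact: Pj.
  by apply: well_cvg; apply: Qj; exact: ltnW.
have rhs : (fun k => dotv ((d k)^-1 *: (q k (i k + m)%N - q k (i k)))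
      ((d k)^-1 *: (q k (i k + m)%N - q k (i k))) / (2 * m'%:R) +
    \sum_(j < m') (well V h (q k (i k) + (j%:R / m'%:R) *: (q k (i k + m)%N - q k (i k))) + d k))
   @ U --> dotv (m%:R *: P t) (m%:R *: P t) / (2 * m'%:R) + \sum_(j < m') (w + 0).
  apply: cvgD; first by apply: cvgMr_tmp; apply: dotv_cvg.
  apply: cvg_sumr => j; apply: cvgD => //; apply: well_cvg.
  rewrite -[X in _ --> X]addr0; apply: cvgD => //.
  rewrite -[X in _ --> X](scaler0 _ (j%:R / m'%:R)); apply: cvgZl_tmp.
  by rewrite -(subrr (Q t)); apply: cvgB => //; exact: Qj.
have := @ler_cvg_to nat U _ R _ _ _ _ lhs rhs
  (filterS (fun k imk => @orbit_chord _ _ _ _ _ _ _ _ _ _ _ (qo k) (i k) m m' imk m'0) im).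
rewrite !sumr_const !card_ord !addr0 dotvZl dotvZr -/E.
rewrite -[(E + w) *+ m]mulr_natl -[w *+ m']mulr_natl.
have -> : m%:R * (m%:R * dotv (P t) (P t)) / (2 * m'%:R) = m%:R ^+ 2 * E / m'%:R.
  by rewrite /E; field; rewrite pnatr_eq0 -lt0n.
by move=> H; apply: H.
Qed.

Let energy t : 0 <= t <= T -> dotv (P t) (P t) / 2 + V (Q t) = h.
Proof.
move=> tT; pose E := dotv (P t) (P t) / 2; pose w := well V h (Q t).
suff : E = w.
  have Vh := Q_le tT.
  by rewrite /E /w => ->; rewrite /well max_l ?subr_ge0// subrK.
have arch (a b : R) : (forall m, m.+1%:R * a <= b) -> a <= 0.
  move=> ab; rewrite leNgt; apply/negP => a0.
  have := ab (Num.bound (b / a)); rewrite -ler_pdivlMr// leNgt.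
  by rewrite (lt_trans (unstable.ltr_bound _))// ltr_nat.
apply/eqP; rewrite eq_le -(subr_le0 w) -(subr_le0 E); apply/andP; split.
(* Using one step more and clearing the denominator leaves (m + 1)(E - w) <= w for every [m]. *)
- apply: (arch _ w) => m; have := @energy_chord t m.+1 m.+2 tT isT; rewrite -/E -/w; cbv zeta.
  rewrite -[m.+2%:R]natr1; move: (m.+1%:R : R) (ltr0Sn R m) => x x0 H.
  have x1 : 0 < x + 1 by lra.
  have : (x ^+ 2 * E / (x + 1)) * (x + 1) = x ^+ 2 * E by rewrite divfK// gt_eqF.
  move: (_ / (x + 1)) H => Z H ZE; clearbody E w; by have := ler_wpM2r (ltW x1) H; nra.
(* Using one step fewer leaves (m + 1)(w - E) <= E. *)
- apply: (arch _ E) => m; have := @energy_chord t m.+2 m.+1 tT isT; rewrite -/E -/w; cbv zeta.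
  rewrite -[m.+2%:R]natr1; move: (m.+1%:R : R) (ltr0Sn R m) => x x0 H.
  have : ((x + 1) ^+ 2 * E / x) * x = (x + 1) ^+ 2 * E by rewrite divfK// gt_eqF.
  move: (_ / x) H => Z H ZE; clearbody E w; by have := ler_wpM2r (ltW x0) H; nra.
Qed.

(** A Clarke bound at [Q t] holds on a ball, which eventually contains all discrete vertices between
    the times [s1] and [s2]; the integrated discrete inclusion then passes to the limit. *)
Let gradient t u b : 0 <= t <= T -> clarke_bound V (Q t) u b ->
    exists2 r, 0 < r & forall s1 s2 : R, 0 <= s1 -> s1 <= s2 -> s2 <= T ->
      `|s1 - t| < r -> `|s2 - t| < r -> dotv (- (P s2 - P s1)) u <= b * (s2 - s1).
Proof.
move=> tT /clarke_bound_near[r r0 rP].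
have C0 : 0 <= C by exact: le_trans (orbit_velocity (qo 0) (N_gt0 0)).
(* A vertex is within 2 C r' of the one at time [s1], that one within r / 4 of [Q s1], and [Q s1]
   within C r' of [Q t]; the total is below [r] since C r' < r / 4. *)
pose r' := r / (4 * (C + 1)).
have C1 : 0 < C + 1 by rewrite ltr_wpDl.
have r'0 : 0 < r' by rewrite divr_gt0// mulr_gt0.
have Cr : C * r' + r' = r / 4 by rewrite /r'; field; rewrite gt_eqF.
exists r' => // s1 s2 s10 s12 s2T s1t s2t.
have s1T : 0 <= s1 <= T by rewrite s10 (le_trans s12).
have s2T' : 0 <= s2 <= T by rewrite s2T (le_trans s10).
have s1c := idx_cvg 1 s1T; have s2c := idx_cvg 1 s2T'.
have lhs : (fun k => dotv (- (v k (idx 1 s2 k) - v k (idx 1 s1 k))) u) @ U -->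
    dotv (- (P s2 - P s1)) u.
  apply: dotv_cvg; last exact: cvg_cst.
  by apply: cvgN; exact: cvgB (@Pcvg s2) (@Pcvg s1).
have rhs : (fun k => b * ((idx 1 s2 k)%:R * d k - (idx 1 s1 k)%:R * d k)) @ U --> b * (s2 - s1).
  by apply: cvgMl_tmp; exact: cvgB.
apply: (@ler_cvg_to nat U _ R _ _ _ _ lhs rhs).
have Qs1 : (fun k => q k (idx 1 s1 k)) @ U --> Q s1.
  by apply: Qlim => //; apply: nearW => k; exact: ltnW.
have dc : (fun k => (idx 1 s2 k)%:R * d k - (idx 1 s1 k)%:R * d k) @ U --> s2 - s1.
  exact: cvgB.
have r4 : 0 < r / 4 by rewrite divr_gt0.
near=> k.
have k1 : `|Q s1 - q k (idx 1 s1 k)| < r / 4.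
  by near: k; move: r4; apply: cvgr_dist_lt Qs1 _.
have k2 : (idx 1 s2 k)%:R * d k - (idx 1 s1 k)%:R * d k < 2 * r'.
  by near: k; apply: (cvgr_lt _ dc); move: s1t s2t; rewrite !ltr_norml; lra.
have ij := idx_mono 1 k s12.
have := @orbit_gradient_sum _ _ _ _ _ _ _ _ _ _ _ (d0 k) (qo k) (idx 1 s1 k)
  (idx 1 s2 k - idx 1 s1 k) u b.
rewrite subnKC// natrB// mulrBl; apply => // l /andP[il lj]; apply: rP.
have lN : (l <= N k)%N by apply: leq_trans lj _; exact: ltnW.
have := orbit_position_dist (d0 k) (qo k) lN (ltnW (idx1_lt s1 k)).
rewrite [X in C * X]ger0_norm ?subr_ge0 ?ler_pM2r// ?ler_nat; last exact: ltnW.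
have lj' : l%:R * d k <= (idx 1 s2 k)%:R * d k by rewrite ler_pM2r// ler_nat.
have : `|Q s1 - Q t| <= C * r'.
  by apply: le_trans (Q_lip tT s1T) _; rewrite ler_wpM2l// ltW.
move=> H1 H2; have H3 := ler_distD (q k (idx 1 s1 k)) (q k l) (Q t).
have H4 := ler_distD (Q s1) (q k (idx 1 s1 k)) (Q t).
rewrite distrC in k1.
have : C * (l%:R * d k - (idx 1 s1 k)%:R * d k) <= C * (2 * r').
  by rewrite ler_wpM2l// (le_trans _ (ltW k2))// lerD2r.
move=> H5; have H6 := le_trans H2 H5; clear H2 H5 k2 lj'; clearbody r'; lra.
Unshelve. all: by end_near. Qed.

Lemma limit_brake_arc : brake_arc V h L T Q P.
Proof.
by split => //; apply/eqP; rewrite eq_le QT_ge Q_le.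
Qed.
End limit_arc.

(** * Extension by symmetry *)

Section symmetries.
Context {R : realType} {n : nat}.
Variables (V : 'rV[R]_n -> R) (h L T : R) (q v : R -> 'rV[R]_n).
Hypothesis A : energy_arc V h L T q v.

Let flipT (s : R) : 0 <= s <= T -> 0 <= T - s <= T.
Proof. by move=> /andP[s0 sT]; apply/andP; split; lra. Qed.

Lemma energy_arc_reverse :
  energy_arc V h L T (fun t => q (T - t)) (fun t => - v (T - t)).
Proof.
split=> [s t /flipT sT /flipT tT|s t /flipT sT /flipT tT|t /flipT tT|t u b /flipT tT].
- rewrite -opprD normrN; have := energy_arc_lip A sT tT.
  have -> : T - t - (T - s) = - (t - s) by lra.
  by rewrite [X in _ * X]normrN.
- have := energy_arc_taylor A sT tT.
  have -> : T - t - (T - s) = - (t - s) by lra.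
  by rewrite sqrrN scaleNr scalerN.
- by rewrite dotvNl dotvNr opprK; exact: (energy_arcE A tT).
- move=> /(energy_arc_gradient A tT)[r r0 H]; exists r => // s1 s2 s10 s12 s2T s1t s2t.
  have flip (s : R) : `|T - s - (T - t)| = `|s - t|.
    by rewrite -normrN; congr `|_|; lra.
  have := H (T - s2) (T - s1); rewrite !flip => {}H.
  have -> : s2 - s1 = T - s1 - (T - s2) by lra.
  by rewrite opprK addrC; apply: H => //; lra.
Qed.

Lemma energy_arc_opp : (forall x, V (- x) = V x) ->
  energy_arc V h L T (fun t => - q t) (fun t => - v t).
Proof.
move=> ev.
split=> [s t sT tT|s t sT tT|t tT|t u b tT].
- by rewrite -opprD normrN; exact: (energy_arc_lip A sT tT).
- by rewrite scalerN -!opprD normrN; exact: (energy_arc_taylor A sT tT).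
- by rewrite dotvNl dotvNr opprK ev; exact: (energy_arcE A tT).
- move=> /(clarke_bound_opp ev)/(energy_arc_gradient A tT)[r r0 H]; exists r => //.
  move=> s1 s2 s10 s12 s2T s1t s2t; have := H s1 s2 s10 s12 s2T s1t s2t.
  by rewrite dotvNr -dotvNl !opprB opprK addrC.
Qed.
End symmetries.

Section periodic_extension.
Context {R : realType} {n : nat}.
Variables (V : 'rV[R]_n -> R) (h L T : R) (q v : R -> 'rV[R]_n).
Hypothesis ev : forall x, V (- x) = V x.
Hypothesis T0 : 0 < T.
Hypothesis q0 : q 0 = 0.
Hypothesis vT : v T = 0.
Hypothesis A : energy_arc V h L T q v.
Implicit Types (s t r : R) (m : int) (c : nat).

(* An arc from the origin to a point of rest extends by time reversal at the
   point of rest and by oddness at the origin: the four quarters of a period are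
   the images of the arc under these two symmetries. *)
Definition quarter_position (T : R) (q : R -> 'rV[R]_n) (c : nat) (r : R) : 'rV[R]_n :=
  match c with 0 => q r | 1 => q (T - r) | 2 => - q r | _ => - q (T - r) end.

(** The double negation makes the last quarter literally the opposite of the reversed arc. *)
Definition quarter_velocity (T : R) (v : R -> 'rV[R]_n) (c : nat) (r : R) : 'rV[R]_n :=
  match c with 0 => v r | 1 => - v (T - r) | 2 => - v r | _ => - - v (T - r) end.

Definition phase (m : int) : nat := `|(m %% 4)%Z|%N.

Definition extend_position t :=
  let m := Num.floor (t / T) in quarter_position T q (phase m) (t - m%:~R * T).

Definition extend_velocity t :=
  let m := Num.floor (t / T) in quarter_velocity T v (phase m) (t - m%:~R * T).

Local Notation Q := extend_position.
Local Notation P := extend_velocity.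

Lemma quarter_arc c : energy_arc V h L T (quarter_position T q c) (quarter_velocity T v c).
Proof.
case: c => [|[|[|c]]] //=.
- exact: energy_arc_reverse.
- exact: energy_arc_opp.
- exact: energy_arc_opp (energy_arc_reverse A) ev.
Qed.

Lemma phaseP m : [\/ phase m = 0%N /\ phase (m + 1) = 1%N, phase m = 1%N /\ phase (m + 1) = 2%N,
  phase m = 2%N /\ phase (m + 1) = 3%N | phase m = 3%N /\ phase (m + 1) = 0%N].
Proof.
have : phase m = 0%N /\ phase (m + 1) = 1%N \/ phase m = 1%N /\ phase (m + 1) = 2%N \/
  phase m = 2%N /\ phase (m + 1) = 3%N \/ phase m = 3%N /\ phase (m + 1) = 0%N.
  rewrite /phase; lia.
by case=> [|[|[|]]]; [constructor 1|constructor 2|constructor 3|constructor 4].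
Qed.

(** At the point of rest [v T = 0] reconciles the two signs of the velocity; at the origin [q 0 = 0]
    reconciles those of the position. *)
Lemma quarter_glue m :
  quarter_position T q (phase (m + 1)) 0 = quarter_position T q (phase m) T /\
  quarter_velocity T v (phase (m + 1)) 0 = quarter_velocity T v (phase m) T.
Proof.
by case: (phaseP m) => -[-> ->] /=; rewrite ?subrr ?subr0 ?q0 ?vT ?oppr0 ?opprK.
Qed.

(** [Num.floor] assigns a joint to the piece on its right; gluing makes the left formula valid there
    too, so the pieces may be taken closed. *)
Lemma extend_piece m t : m%:~R * T <= t <= (m + 1)%:~R * T ->
  Q t = quarter_position T q (phase m) (t - m%:~R * T) /\
  P t = quarter_velocity T v (phase m) (t - m%:~R * T).
Proof.
move=> /andP[mt tm]; rewrite /Q /P.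
have [tm'|tm'] := ltP t ((m + 1)%:~R * T).
  have -> : Num.floor (t / T) = m.
    by apply: floor_def; rewrite ler_pdivlMr// mt ltr_pdivrMr.
  by [].
have te : t = (m + 1)%:~R * T by apply/eqP; rewrite eq_le tm tm'.
have -> : Num.floor (t / T) = m + 1 by rewrite te mulfK ?gt_eqF// intrKfloor.
have -> : t - (m + 1)%:~R * T = 0 by rewrite te subrr.
have -> : t - m%:~R * T = T by rewrite te intrD mulrDl mul1r addrAC subrr add0r.
exact: quarter_glue.
Qed.

Let pieceT m t : m%:~R * T <= t <= (m + 1)%:~R * T -> 0 <= t - m%:~R * T <= T.
Proof. by rewrite intrD mulrDl mul1r => /andP[mt tm]; apply/andP; split; lra. Qed.


Definition in_piece m t : bool := m%:~R * T <= t <= (m + 1)%:~R * T.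

Lemma floor_piece t :
  (Num.floor (t / T))%:~R * T <= t < (Num.floor (t / T) + 1)%:~R * T.
Proof. by rewrite -ler_pdivlMr// -ltr_pdivrMr// floor_itv. Qed.

Lemma in_floor_piece t : in_piece (Num.floor (t / T)) t.
Proof. by have /andP[a b] := floor_piece t; rewrite /in_piece a ltW. Qed.

Lemma extend_energy t : dotv (P t) (P t) / 2 + V (Q t) = h.
Proof.
have tm := in_floor_piece t; have [-> ->] := extend_piece tm.
exact: (energy_arcE (quarter_arc _) (pieceT tm)).
Qed.

Lemma piece_velocity_lip m s t : in_piece m s -> in_piece m t -> `|P t - P s| <= L * `|t - s|.
Proof.
move=> sm tm; have [_ ->] := extend_piece sm; have [_ ->] := extend_piece tm.
have := energy_arc_lip (quarter_arc (phase m)) (pieceT sm) (pieceT tm).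
by have -> : t - m%:~R * T - (s - m%:~R * T) = t - s by lra.
Qed.

Lemma piece_taylor m s t : in_piece m s -> in_piece m t ->
  `|Q t - Q s - (t - s) *: P s| <= L * (t - s) ^+ 2.
Proof.
move=> sm tm; have [-> ->] := extend_piece sm; have [-> _] := extend_piece tm.
have := energy_arc_taylor (quarter_arc (phase m)) (pieceT sm) (pieceT tm).
by have -> : t - m%:~R * T - (s - m%:~R * T) = t - s by lra.
Qed.

(** At a joint the piece depends on the side of [t], but either one contains [s], so two-sided
    limits reduce to estimates within one piece. *)
Lemma same_piece s : exists2 r, 0 < r &
  forall t, `|t - s| < r -> exists m, in_piece m s /\ in_piece m t.
Proof.
have /andP[ms sm] := floor_piece s; set m := Num.floor _ in ms sm.
have m1 (k : int) : (k + 1)%:~R * T = k%:~R * T + T by rewrite intrD mulrDl mul1r.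
have [e|ne] := eqVneq (m%:~R * T) s.
  exists T => // t; rewrite ltr_norml => /andP[t1 t2].
  have [ts|st] := leP t s; [exists (m - 1)|exists m]; rewrite /in_piece.
    have : (m - 1)%:~R * T = s - T by rewrite -e intrB mulrBl mul1r.
    by rewrite subrK e => ->; split; apply/andP; split; lra.
  by rewrite m1 e; split; apply/andP; split; lra.
have ms' : m%:~R * T < s by rewrite lt_neqAle ne.
exists (Num.min (s - m%:~R * T) ((m + 1)%:~R * T - s)); first by rewrite lt_min !subr_gt0 ms'.
move=> t; rewrite lt_min !ltr_norml => /andP[/andP[t1 t2] /andP[t3 t4]]; exists m.
by split; apply/andP; split; lra.
Qed.

(** Induction on the number of joints crossed: lengths add up along the line, so the constant stays
    [L]. *)
Lemma extend_velocity_lip s t : `|P t - P s| <= L * `|t - s|.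
Proof.
wlog st : s t / s <= t => [H|].
  by have [/H|/ltW/H] := leP s t => //; rewrite distrC [`|s - t|]distrC.
have T0' := T0.
have m1 (k : int) : (k + 1)%:~R * T = k%:~R * T + T by rewrite intrD mulrDl mul1r.
have chain (k : nat) : forall m t, in_piece m s -> in_piece (m + k%:Z) t -> s <= t ->
    `|P t - P s| <= L * (t - s).
  elim: k => [|k IH] m {st}t sm tm st.
    by have := piece_velocity_lip sm; rewrite addr0 in tm => /(_ _ tm); rewrite ger0_norm ?subr_ge0.
  pose p := (m + k.+1%:Z)%:~R * T.
  have pt : p <= t by case/andP: tm.
  have pE : p = (m + k%:Z)%:~R * T + T by rewrite /p -m1; congr (_%:~R * T); lia.
  have sp : s <= p.
    case/andP: sm => _ sm; apply: le_trans sm _; rewrite /p ler_pM2r// ler_int; lia.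
  have pm1 : in_piece (m + k%:Z) p by rewrite /in_piece m1 pE; apply/andP; split; lra.
  have pm2 : in_piece (m + k.+1%:Z) p by rewrite /in_piece m1 -/p; apply/andP; split; lra.
  have := IH m p sm pm1 sp; have := piece_velocity_lip pm2 tm.
  rewrite [X in L * X]ger0_norm ?subr_ge0// => H1 H2.
  by apply: le_trans (ler_distD (P p) _ _) _; lra.
rewrite [X in L * X]ger0_norm ?subr_ge0//.
have fl : Num.floor (s / T) <= Num.floor (t / T).
  by apply: le_floor; rewrite ler_pM2r// invr_gt0.
apply: (chain `|Num.floor (t / T) - Num.floor (s / T)|%N (Num.floor (s / T))) => //.
  exact: in_floor_piece.
by rewrite gez0_abs ?subr_ge0// subrKC; exact: in_floor_piece.
Qed.

Lemma extend_derive t : derivable Q t 1 /\ derive1 Q t = P t.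
Proof.
have L0 : 0 <= L.
  by have := extend_velocity_lip 0 1; rewrite subr0 normr1 mulr1; exact: le_trans.
have [r r0 H] := same_piece t.
have lim : (fun e => e^-1 *: (Q (e + t) - Q t)) @ (0 : R)^' --> P t.
  apply/cvgrPdist_le => /= e e0; near=> x.
  have x0 : x != 0 by near: x; exact: nbhs_dnbhs_neq.
  have xr : `|x| < r by near: x; exact: dnbhs0_lt.
  have xe : `|x| < e / (L + 1) by near: x; apply: dnbhs0_lt; rewrite divr_gt0// ltr_wpDl.
  have [|m [tm xm]] := H (x + t); first by rewrite addrK.
  have := piece_taylor tm xm; rewrite addrK => HT.
  have xn : 0 < `|x| by rewrite normr_gt0.
  rewrite distrC -(ler_pM2l xn) -normrZ scalerBr scalerA divff// scale1r.
  apply: le_trans HT _; rewrite -real_normK ?num_real// expr2 mulrCA ler_pM2l//.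
  by move: xe; rewrite ltr_pdivlMr ?ltr_wpDl// mulrC; nra.
by split; [apply/cvg_ex; exists (P t); under eq_fun do rewrite [_ *: 1]mulr1|exact: cvg_lim].
Unshelve. all: by end_near. Qed.

(** Where [P] is differentiable the right difference quotient determines the derivative, and it
    stays in the piece starting at or before [t]; the integrated inclusion bounds it by every [b]
    that bounds the directional derivative. *)
Lemma extend_grad t : derivable P t 1 -> clarke_grad V (Q t) (- derive1 P t).
Proof.
move=> dP u; apply: le_clarke_dirP => b.
have /andP[mt tm] := floor_piece t; set m := Num.floor _ in mt tm.
have tm' : in_piece m t by rewrite /in_piece mt ltW.
have [-> _] := extend_piece tm'.
move=> /(energy_arc_gradient (quarter_arc (phase m)) (pieceT tm'))[r r0 H].
have lim : (fun e => e^-1 *: (P (e + t) - P t)) @ (0 : R)^'+ --> derive1 P t.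
  apply: cvg_dnbhs_at_right; rewrite derive1E.
  have : (fun e => e^-1 *: ((P \o shift t) (e *: 1) - P t)) @ (0 : R)^' --> 'D_1 P t by exact: dP.
  by under eq_fun do rewrite /= [_ *: 1]mulr1.
have lim2 : (fun e => dotv (- (e^-1 *: (P (e + t) - P t))) u) @ (0 : R)^'+ -->
    dotv (- derive1 P t) u.
  by apply: dotv_cvg; [exact: cvgN|exact: cvg_cst].
apply: (@ler_cvg_to _ _ _ R _ (fun=> b) _ _ lim2); first exact: cvg_cst.
near=> e; have e0 : 0 < e by [].
have er : e < r by near: e; exact: nbhs_right_lt.
have em : e < (m + 1)%:~R * T - t by near: e; apply: nbhs_right_lt; rewrite subr_gt0.
have tem : in_piece m (e + t) by apply/andP; split; lra.
have [_ ->] := extend_piece tem; have [_ ->] := extend_piece tm'.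
have := H (t - m%:~R * T) (e + t - m%:~R * T).
have -> : e + t - m%:~R * T - (t - m%:~R * T) = e by lra.
rewrite subrr normr0 gtr0_norm// => {}H.
rewrite dotvNl dotvZl -[- (e^-1 * _)]mulrN -dotvNl ler_pdivrMl// [e * b]mulrC; apply: H => //.
- by rewrite subr_ge0.
- by rewrite lerD2r lerDr ltW.
- by case/andP: (pieceT tem).
Unshelve. all: by end_near. Qed.

Lemma extend_periodic : periodic Q (4 * T).
Proof.
move=> t; rewrite /Q.
have -> : (t + 4 * T) / T = t / T + 4%:~R by rewrite mulrDl mulfK ?gt_eqF.
rewrite floorDrz ?intr_int// intrKfloor; congr (quarter_position T q _ _).
  by rewrite /phase modzDr.
by rewrite intrD mulrDl; lra.
Qed.

Lemma extend0 : Q 0 = 0.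
Proof.
have p0 : in_piece 0 0 by rewrite /in_piece add0r mul0r mul1r lexx ltW.
by have [-> _] := extend_piece p0; rewrite mul0r subr0 /phase /= q0.
Qed.

End periodic_extension.

(* Limits are taken along an ultrafilter, so that no subsequence is extracted. *)
Lemma discrete_orbits_limit (R : realType) n (V : 'rV[R]_n -> R) (h M C L Tm : R) :
  continuous V -> V 0 < h -> 0 <= L ->
  (forall k, exists q N, discrete_orbit V h M C L Tm k.+1%:R^-1 q N) ->
  exists T q v, brake_arc V h L T q v.
Proof.
move=> Vc V0h L0 /choice[q /choice[N qo]].
have [U [UU Uoo]] := @ultraFilterLemma nat \oo _.
have [T NT] : exists T : R, (fun k => (N k)%:R * k.+1%:R^-1) @ U --> T.
  apply: (@ultra_bounded_cvgR _ _ _ Tm) => k.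
  by rewrite ger0_norm ?divr_ge0//; exact: orbit_time (qo k).
have N0 k : (0 < N k)%N.
  have := orbit_end (qo k); case: (N k) => // hV.
  by move: V0h; rewrite -(orbit0 (qo k)) ltNge hV.
have /choice[Q Qcvg] : forall t : R, exists l : 'rV[R]_n,
    (fun k => q k (minn (Num.truncn (t / k.+1%:R^-1)) (N k - 0))) @ U --> l.
  by move=> t; apply: ultra_bounded_cvg => k; exact: orbit_bounded (qo k) _.
have /choice[P Pcvg] : forall t : R, exists l : 'rV[R]_n,
    (fun k => velocity k.+1%:R^-1 (q k) (minn (Num.truncn (t / k.+1%:R^-1)) (N k - 1))) @ U --> l.
  move=> t; apply: ultra_bounded_cvg => k; apply: (orbit_velocity (qo k)).
  by apply: leq_ltn_trans (geq_minr _ _) _; rewrite subn1 prednK.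
by exists T, Q, P; exact: (limit_brake_arc Vc V0h L0 UU Uoo qo NT Qcvg Pcvg).
Qed.

Theorem theorem3p1 (R : realType) (n : nat) (n_gt0 : (0 < n)%N)
    (V : 'rV[R]_n -> R) (h mu1 mu2 : R)
    (V_lip : locally_lipschitz V)
    (V1 : forall q : 'rV[R]_n, V (- q) = V q)
    (mu1_gt0 : 0 < mu1) (mu2_ge0 : 0 <= mu2)
    (V2 : forall q y : 'rV[R]_n, clarke_grad V q y ->
            mu1 * V q - mu2 <= dotv y q)
    (V3 : exists2 M : R, 0 < M &
            forall q : 'rV[R]_n, M <= enorm q -> h <= V q)
    (h_gt : mu2 / mu1 < h) :
  exists (q : R -> 'rV[R]_n) (T : R),
    [/\ 0 < T,
        periodic q T,
        ~ (exists c : 'rV[R]_n, forall t : R, q t = c),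
        inclusion_solution V q &
        has_energy V h q].
Proof.
have Vc : continuous V.
  by move=> x; have [L _ /lipschitz_near_continuous] := locally_lipschitzP V_lip x.
have h_gt' : mu2 < mu1 * h by move: h_gt; rewrite ltr_pdivrMr// mulrC.
have V0h : V 0 < h.
  have := V2 0 0 (clarke_grad0 V1); rewrite dotv0l subr_le0 => H.
  by rewrite -(ltr_pM2l mu1_gt0); exact: le_lt_trans H h_gt'.
have [M M0 VM'] := V3.
have VM x : V x < h -> `|x| < M.
  move=> Vx; apply: le_lt_trans (norm_le_enorm x) _.
  by rewrite ltNge; apply/negP => /VM'; rewrite leNgt Vx.
pose B : set 'rV[R]_n := [set x | `|x| <= M].
have cB : compact B by exact: norm_ball_compact.
have [L L0 VL] := lipschitz_near_uniform V_lip cB.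
have B0 : B !=set0 by exists 0; rewrite /B/= normr0 ltW.
have [c cK cmax] := compact_EVT_max B0 cB
  (continuous_subspaceT (@well_continuous _ _ V h Vc)).
have well_le x : `|x| <= M -> well V h x <= well V h c.
  by move=> xM; apply: cmax; exact: mem_set.
(* A point of Euclidean norm exactly [M], where (V3) gives V >= h: the target of the straight
   competitor. *)
pose p : 'rV[R]_n := M *: delta_mx ord0 (Ordinal n_gt0).
have pM : enorm p = M.
  apply/eqP; rewrite -(eqrXn2 (n := 2))// ?sqrtr_ge0// ?ltW//.
  by rewrite enorm_sqr /p dotvZl dotvZr dotv_delta mxE !eqxx mulr1 expr2.
have pB : `|p| <= M by rewrite -pM norm_le_enorm.
have [C [Tm orbits]] := discrete_orbit_exists Vc V0h VM mu1_gt0 V2 h_gt' well_le L0 VL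
   pB (VM' p (eq_ind_r (fun z => M <= z) (lexx M) pM)).
have [T [q [v arc]]] := discrete_orbits_limit Vc V0h L0 orbits.
have T0 := arc_time arc; have q0 := arc_start arc; have A := arc_energy_arc arc.
(* At time [T] the potential alone equals [h], so no kinetic energy is left. *)
have vT : v T = 0.
  have := energy_arcE A (t := T); rewrite lexx ltW// (arc_end arc) => /(_ isT) E.
  have E0 : dotv (v T) (v T) = 0 by lra.
  apply/eqP; rewrite -normr_le0; apply: norm_le_of_dotv => //.
  by rewrite E0 expr2 mulr0.
pose Q := extend_position T q; pose P := extend_velocity T v.
have dQ t := extend_derive V1 T0 q0 vT A t.
have QP : derive1 Q = P by apply/funext => t; have [] := dQ t.
have Plip s t : `|P s - P t| <= L * `|s - t|.
  exact: (extend_velocity_lip V1 T0 q0 vT A t s).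
have energy t : dotv (P t) (P t) / 2 + V (Q t) = h.
  exact: (extend_energy V1 T0 q0 vT A).
exists Q, (4 * T); split.
- by rewrite mulr_gt0.
- exact: (extend_periodic q T0).
(* A constant curve would stay at the origin with zero velocity, and its energy would be V(0) <
   h. *)
- move=> [x Qx].
  have P0 : P 0 = 0.
    rewrite -QP (_ : Q = cst x) ?derive1_cst//; exact/funext.
  have := energy 0; rewrite P0 dotv0l mul0r add0r /Q (extend0 T0 q0 vT) => E.
  by move: V0h; rewrite E ltxx.
- split; first by move=> t; have [] := dQ t.
  + move=> a b ab e e0; have L1 : 0 < L + 1 by rewrite ltr_wpDl.
    exists (e / (L + 1)); first by rewrite divr_gt0.
    move=> N l r lr _; rewrite ltr_pdivlMr// => Hlt.
    rewrite QP; apply: le_lt_trans _ Hlt; rewrite mulr_suml.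
    apply: ler_sum => i _; apply: le_trans (Plip _ _) _.
    have [_ [lri _]] := lr i (ltn_ord i).
    rewrite ger0_norm ?subr_ge0// mulrC ler_wpM2l ?subr_ge0//; lra.
  + have := lipschitz_derivable_rV_ae Plip.
    rewrite QP; apply: filterS; first exact: (ae_filter_ringOfSetsType (@lebesgue_measure R)).
    move=> t dP; split => //.
    exact: (extend_grad V1 T0 q0 vT A dP).
- move=> t; rewrite QP enorm_sqr mulrC; exact: energy.
Qed.
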